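(* Let $r\ge1$ and let $\mathrm{LP}_r(t)$ be the real linear program obtained from $\mathrm{LP}_r$ (described in the context) by substituting a real number $t$ for the parameter. Let $\mathcal C_t(\lambda)$ denote the point with parameter $\mu=t^\lambda$ of the primal-dual central path of $\mathrm{LP}_r(t)$ and its dual. Then $$\liminf_{t\to+\infty}\kappa(\mathcal C_t,[0,2])\ \ge\ (2^{r-1}-1)\frac{\pi}{2}.$$ The same bound holds for the primal central path $\lambda\mapsto(x,w)$-component of $\mathcal C_t(\lambda)$. In particular, the total curvatures of the whole primal-dual central path and of the whole primal central path of $\mathrm{LP}_r(t)$ have limit inferior at least $(2^{r-1}-1)\pi/2$ as $t\to+\infty$.
   Context: $\mathrm{LP}_r(t)$ is a linear program with $3r+4$ inequalities in dimension $2r+2$. In equality form, its decision variables are $x=(u_0,v_0,\dots,u_r,v_r)\in\mathbb R^{2r+2}$ and its slack variables are $w=(z_0,h_0,z_1,z'_1,h_1,\dots,z_r,z'_r,h_r)\in\mathbb R^{3r+2}$, all $\ge0$. The problem is: minimize $v_0$ subject to - $u_0+z_0=t$ and $v_0+h_0=t^2$; - for $1\le i\le r$: $u_i+z_i=tu_{i-1}$, $u_i+z'_i=tv_{i-1}$, and $v_i+h_i=t^{1-2^{-i}}(u_{i-1}+v_{i-1})$. Writing this as: minimize $c^Tx$ subject to $Ax+w=b$, $x,w\ge0$, with dual: maximize $-b^Ty$ subject to $-A^Ty+s=c$, $y,s\ge0$. Both are strictly feasible for large $t$. The central path point with parameter $\mu>0$ is the unique solution $(x,w,y,s)$ of $Ax+w=b$,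 $-A^Ty+s=c$, $w_iy_i=x_js_j=\mu$ for all $i,j$, $x,w,y,s>0$. Total curvature: for a polygonal curve, it is the sum of the angles between consecutive segments, where the angle between segments $UV$ and $VW$ is the angle in $[0,\pi]$ between the vectors $V-U$ and $W-V$. For a curve $\sigma:[a,b]\to\mathbb R^p$, $\kappa(\sigma,[a,b])$ is the supremum of the total curvatures of polygonal curves with vertices $\sigma(\tau_0),\dots,\sigma(\tau_N)$, $a\le\tau_0<\dots<\tau_N\le b$. *)

(* Defs.v *)
From Stdlib Require Import Reals Lra Lia Arith List ClassicalEpsilon.
Open Scope R_scope.

Fixpoint sumn (n : nat) (f : nat -> R) : R :=
  match n with
  | O => 0
  | S k => sumn k f + f k
  end.

(** ** The linear program LP_r(t):  min c^T x  s.t.  A x + w = b, x, w >= 0.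
    n = 2r+2 decision variables x = (u_0,v_0,...,u_r,v_r), u_i = x(2i), v_i = x(2i+1).
    m = 3r+2 rows / slack variables w = (z_0,h_0,z_1,z'_1,h_1,...,z_r,z'_r,h_r):
    row 0 : u_0 + z_0 = t,   row 1 : v_0 + h_0 = t^2,
    row 3i-1 : u_i - t u_{i-1} + z_i = 0,
    row 3i   : u_i - t v_{i-1} + z'_i = 0,
    row 3i+1 : v_i - t^{1-2^{-i}} (u_{i-1}+v_{i-1}) + h_i = 0      (1 <= i <= r). *)

Definition nvar (r : nat) : nat := 2 * r + 2.
Definition ncon (r : nat) : nat := 3 * r + 2.

Definition LP_A (r : nat) (t : R) (k j : nat) : R :=
  if Nat.eqb k 0 then (if Nat.eqb j 0 then 1 else 0)
  else if Nat.eqb k 1 then (if Nat.eqb j 1 then 1 else 0)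
  else
    let i := ((k + 1) / 3)%nat in
    match ((k + 1) mod 3)%nat with
    | O =>  (* row 3i-1 : u_i - t u_{i-1} *)
        if Nat.eqb j (2 * i) then 1
        else if Nat.eqb j (2 * i - 2) then - t else 0
    | 1%nat => (* row 3i : u_i - t v_{i-1} *)
        if Nat.eqb j (2 * i) then 1
        else if Nat.eqb j (2 * i - 1) then - t else 0
    | _ => (* row 3i+1 : v_i - t^{1-2^{-i}} (u_{i-1} + v_{i-1}) *)
        if Nat.eqb j (2 * i + 1) then 1
        else if orb (Nat.eqb j (2 * i - 2)) (Nat.eqb j (2 * i - 1))
             then - Rpower t (1 - / 2 ^ i) else 0
    end.

Definition LP_b (t : R) (k : nat) : R :=
  if Nat.eqb k 0 then t else if Nat.eqb k 1 then t ^ 2 else 0.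

Definition LP_c (j : nat) : R := if Nat.eqb j 1 then 1 else 0.

(** ** Central path.
    A primal-dual point (x,w,y,s) is encoded as one vector P : nat -> R of
    dimension 2n+2m:  x_j = P j, w_k = P (n+k), y_k = P (n+m+k), s_j = P (n+2m+j).
    The primal part (x,w) consists of the first n+m coordinates. *)
Definition pd_dim (r : nat) : nat := 2 * nvar r + 2 * ncon r.
Definition primal_dim (r : nat) : nat := nvar r + ncon r.

Definition is_central_point (r : nat) (t mu : R) (P : nat -> R) : Prop :=
  let n := nvar r in let m := ncon r in
  let x := fun j => P j in
  let w := fun k => P (n + k)%nat in
  let y := fun k => P (n + m + k)%nat in
  let s := fun j => P (n + 2 * m + j)%nat in
  (forall k, (k < m)%nat ->
     sumn n (fun j => LP_A r t k j * x j) + w k = LP_b t k /\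
     w k * y k = mu /\ 0 < w k /\ 0 < y k) /\
  (forall j, (j < n)%nat ->
     - sumn m (fun k => LP_A r t k j * y k) + s j = LP_c j /\
     x j * s j = mu /\ 0 < x j /\ 0 < s j).

(** The central path point with parameter mu (the unique solution, chosen by
    Hilbert's epsilon; its coordinates beyond [pd_dim r] are irrelevant). *)
Definition central_point (r : nat) (t mu : R) : nat -> R :=
  epsilon (inhabits (fun _ : nat => 0)) (is_central_point r t mu).

Definition C_path (r : nat) (t : R) (lambda : R) : nat -> R :=
  central_point r t (Rpower t lambda).

(** ** Total curvature in R^d (vectors are the first d coordinates). *)
Definition dot (d : nat) (u v : nat -> R) : R := sumn d (fun i => u i * v i).
Definition vnorm (d : nat) (u : nat -> R) : R := sqrt (dot d u u).
Definition vsub (u v : nat -> R) : nat -> R := fun i => u i - v i.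

(** angle in [0,pi] between two vectors (0 by convention if one vanishes) *)
Definition vangle (d : nat) (u v : nat -> R) : R :=
  if Req_EM_T (vnorm d u * vnorm d v) 0 then 0
  else acos (dot d u v / (vnorm d u * vnorm d v)).

Fixpoint poly_curv (d : nat) (l : list (nat -> R)) : R :=
  match l with
  | U :: ((V :: W :: _) as tl) => vangle d (vsub V U) (vsub W V) + poly_curv d tl
  | _ => 0
  end.

Fixpoint strictly_increasing (l : list R) : Prop :=
  match l with
  | a :: ((b :: _) as tl) => a < b /\ strictly_increasing tl
  | _ => True
  end.

(** [kappa_gt d sigma I c] : the total curvature kappa(sigma, I) (a supremum
    over inscribed polygons, possibly +infinity) is strictly greater than c. *)
Definition kappa_gt (d : nat) (sigma : R -> nat -> R) (I : R -> Prop) (c : R) : Prop :=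
  exists taus : list R,
    strictly_increasing taus /\ Forall I taus /\
    poly_curv d (map sigma taus) > c.

Definition liminf_kappa_ge (d : nat) (sigma : R -> R -> nat -> R) (I : R -> Prop) (L : R) : Prop :=
  forall eps, 0 < eps -> exists T, forall t, T <= t -> kappa_gt d (sigma t) I (L - eps).

Definition interval02 (x : R) : Prop := 0 <= x <= 2.
Definition whole_line (x : R) : Prop := True.

(* Main.v *)
Require Import Defs.
From Stdlib Require Import Reals Lra Lia Arith List Classical ClassicalEpsilon.
Open Scope R_scope.

(** On a logarithmic scale in base [t], the central path converges to its tropical counterpart,
    [u_0 = 1], [v_0 = lambda], [u_i = 1 + min(u_{i-1}, v_{i-1})],
    [v_i = 1 - 2^{-i} + max(u_{i-1}, v_{i-1})].  The upper bounds follow by induction from the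
    constraints and [v_0 <= (n+m) mu] (duality gap, [b >= 0]); the lower bounds hold because a central
    point dominates, up to the factor [n+m+1], every feasible point of cost at most [mu].
    With [q = r - 1], the tropical curve [(u_q, v_q)] on [0,2] is a staircase with [2^q] steps,
    each of which crosses the diagonal.  At the ends [lambda = 2k/2^q] of the steps, the slacks
    [z_r ~ t u_q] and [z'_r ~ t v_q] alternately dominate all other coordinates, primal and dual,
    so consecutive chords are asymptotically orthogonal, and there are [2^q - 1] pairs of them. *)

(** * Finite sums and products *)

(** [C_path] is an [epsilon] choice, so nothing is known about it until a central point is shown to
    exist; this is what the compactness argument for the barrier provides. From then on only orders
    of magnitude at the 2^q + 1 points [grid q k] matter, and neither continuity nor derivatives in
    lambda enter. Write d = 2^-q and E = [top_exp q k]. The larger of u_q, v_q has tropical exponent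
    E - 1 and the smaller E - 1 - d, so exactly one of the slacks t u_q - u_r and t v_q - u_r has
    order t^E. The closest competitors are v_r and h_r, bounded at exponent E - d/2; this is the
    origin of the margin d/2. A dual coordinate is mu over a primal one, and primal ones are bounded
    below by a positive constant because tropical exponents are nonnegative for lambda in [0,2]; so
    it is O(t^lambda), below the margin too. Passing to the next grid point raises E by d. Hence the
    starting point of a chord is negligible against its end point, and the chord is nearly parallel
    to the axis of the slack that dominates at the end point. *)

Lemma sumn_ext n f g : (forall i, (i < n)%nat -> f i = g i) -> sumn n f = sumn n g.
Proof.
  induction n as [|n IH]; intros H; simpl; [reflexivity|].
  rewrite IH by (intros; apply H; lia). rewrite H by lia. reflexivity.
Qed.

Lemma sumn_plus n f g : sumn n (fun i => f i + g i) = sumn n f + sumn n g.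
Proof. induction n as [|n IH]; simpl; [|rewrite IH]; ring. Qed.

Lemma sumn_scal n a f : sumn n (fun i => a * f i) = a * sumn n f.
Proof. induction n as [|n IH]; simpl; [|rewrite IH]; ring. Qed.

Lemma sumn_const n a : sumn n (fun _ => a) = INR n * a.
Proof.
  induction n as [|n IH]; [simpl; ring|].
  rewrite S_INR. simpl. rewrite IH. ring.
Qed.

Lemma sumn_exchange n m (f : nat -> nat -> R) :
  sumn n (fun j => sumn m (fun k => f k j)) = sumn m (fun k => sumn n (fun j => f k j)).
Proof.
  induction n as [|n IH]; simpl.
  - rewrite sumn_const. ring.
  - rewrite IH, sumn_plus. reflexivity.
Qed.

Lemma sumn_le n f g : (forall i, (i < n)%nat -> f i <= g i) -> sumn n f <= sumn n g.
Proof.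
  induction n as [|n IH]; intros H; simpl; [lra|].
  apply Rplus_le_compat; [apply IH; intros; apply H|apply H]; lia.
Qed.

Lemma sumn_nonneg n f : (forall i, (i < n)%nat -> 0 <= f i) -> 0 <= sumn n f.
Proof.
  intros H. replace 0 with (sumn n (fun _ => 0)) by (rewrite sumn_const; ring).
  now apply sumn_le.
Qed.

Lemma sumn_term_le n f p :
  (forall i, (i < n)%nat -> 0 <= f i) -> (p < n)%nat -> f p <= sumn n f.
Proof.
  induction n as [|n IH]; intros H Hp; [lia|]; simpl.
  destruct (Nat.eq_dec p n) as [->|].
  - assert (0 <= sumn n f) by (apply sumn_nonneg; intros; apply H; lia). lra.
  - assert (f p <= sumn n f) by (apply IH; [intros; apply H|]; lia).
    assert (0 <= f n) by (apply H; lia). lra.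
Qed.

Lemma sumn_delta n a v :
  (a < n)%nat -> sumn n (fun j => (if Nat.eqb j a then 1 else 0) * v j) = v a.
Proof.
  induction n as [|n IH]; intros H; [lia|]; simpl.
  destruct (Nat.eqb_spec n a) as [->|Hne].
  - rewrite (sumn_ext a _ (fun _ => 0)).
    + rewrite sumn_const. ring.
    + intros i Hi. destruct (Nat.eqb_spec i a); [lia|ring].
  - rewrite IH by lia. ring.
Qed.

Fixpoint prodn (n : nat) (f : nat -> R) : R :=
  match n with
  | O => 1
  | S k => prodn k f * f k
  end.

Lemma prodn_pos n f : (forall i, (i < n)%nat -> 0 < f i) -> 0 < prodn n f.
Proof.
  induction n as [|n IH]; intros H; simpl; [lra|].
  apply Rmult_lt_0_compat; [apply IH; intros; apply H|apply H]; lia.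
Qed.

Lemma prodn_eq0 n f p : (p < n)%nat -> f p = 0 -> prodn n f = 0.
Proof.
  induction n as [|n IH]; intros Hp H; [lia|]; simpl.
  destruct (Nat.eq_dec p n) as [->|]; [rewrite H; ring|].
  rewrite IH by (assumption || lia). ring.
Qed.

Lemma ln_le_mono x y : 0 < x -> x <= y -> ln x <= ln y.
Proof. intros Hx [H| ->]; [left; now apply ln_increasing|lra]. Qed.

Lemma ln_prodn n f :
  (forall i, (i < n)%nat -> 0 < f i) -> ln (prodn n f) = sumn n (fun i => ln (f i)).
Proof.
  induction n as [|n IH]; intros H; simpl; [apply ln_1|].
  rewrite ln_mult, IH; try (intros; apply H; lia); [reflexivity|].
  apply prodn_pos; intros; apply H; lia.
Qed.

(** * Sequential compactness *)

Definition extraction (phi : nat -> nat) : Prop := forall k, (phi k < phi (S k))%nat.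

Lemma extraction_ge phi : extraction phi -> forall k, (k <= phi k)%nat.
Proof. intros H k; induction k as [|k IH]; [lia|]. specialize (H k). lia. Qed.

Lemma extraction_lt phi : extraction phi -> forall i j, (i < j)%nat -> (phi i < phi j)%nat.
Proof.
  intros H i j Hij. induction Hij as [|j _ IH]; [apply H|].
  specialize (H j). lia.
Qed.

Lemma Un_cv_extract U l phi :
  extraction phi -> Un_cv U l -> Un_cv (fun k => U (phi k)) l.
Proof.
  intros Hphi HU eps Heps. destruct (HU eps Heps) as [N HN].
  exists N. intros k Hk. apply HN. pose proof (extraction_ge phi Hphi k). lia.
Qed.

Lemma Un_cv_const a : Un_cv (fun _ => a) a.
Proof. intros e He. exists O. intros. unfold Rdist. rewrite Rminus_diag, Rabs_R0. lra. Qed.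

Lemma inv_INR_S_cv0 : Un_cv (fun k => / (INR k + 1)) 0.
Proof.
  intros eps Heps.
  destruct (archimed_cor1 eps Heps) as [N [HN HN0]].
  exists N. intros k Hk. unfold Rdist.
  assert (INR N <= INR k) by (apply le_INR; lia).
  assert (0 < INR N) by (apply lt_0_INR; lia).
  rewrite Rminus_0_r, Rabs_pos_eq.
  - apply Rle_lt_trans with (/ INR N); [|assumption].
    apply Rinv_le_contravar; lra.
  - left. apply Rinv_0_lt_compat. lra.
Qed.

Lemma bolzano_weierstrass_extraction (U : nat -> R) (a b : R) :
  (forall k, a <= U k <= b) ->
  exists phi l, extraction phi /\ Un_cv (fun k => U (phi k)) l.
Proof.
  intros HU.
  destruct (Bolzano_Weierstrass U (fun c => a <= c <= b)) as [l Hl];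
    [apply compact_P3|exact HU|].
  assert (Hn : forall k N, exists p, (N <= p)%nat /\ Rabs (U p - l) < / (INR k + 1)).
  { intros k N.
    assert (Hk : 0 < / (INR k + 1)).
    { apply Rinv_0_lt_compat. pose proof (pos_INR k). lra. }
    apply (Hl (fun y => Rabs (y - l) < / (INR k + 1)) N).
    exists (mkposreal _ Hk). intros y Hy. exact Hy. }
  assert (Hc : exists g : nat -> nat -> nat, forall k N,
            (N <= g k N)%nat /\ Rabs (U (g k N) - l) < / (INR k + 1)).
  { exists (fun k N => proj1_sig (constructive_indefinite_description _ (Hn k N))).
    intros k N. apply (proj2_sig (constructive_indefinite_description _ (Hn k N))). }
  destruct Hc as [g Hg].
  (* [g k N] finds an index at least [N] within 1/(k+1) of [l]; searching from [S p] makes [phi]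
     strictly increasing. *)
  pose (phi := nat_rect (fun _ => nat) (g O O) (fun k p => g (S k) (S p))).
  exists phi, l. split.
  - intros k. simpl. destruct (Hg (S k) (S (phi k))). fold (phi k). lia.
  - intros eps Heps. destruct (inv_INR_S_cv0 eps Heps) as [N HN].
    exists N. intros k Hk. specialize (HN k Hk). unfold Rdist in *.
    assert (Hb : Rabs (U (phi k) - l) < / (INR k + 1)).
    { destruct k as [|k]; simpl phi; apply Hg. }
    rewrite Rminus_0_r in HN. pose proof (Rle_abs (/ (INR k + 1))). lra.
Qed.

Lemma bolzano_weierstrass_vector n (X : nat -> nat -> R) (a b : R) :
  (forall k j, (j < n)%nat -> a <= X k j <= b) ->
  exists phi L, extraction phi /\
    forall j, (j < n)%nat -> Un_cv (fun k => X (phi k) j) (L j).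
Proof.
  induction n as [|n IH]; intros HX.
  - exists (fun k => k), (fun _ => 0). split; [intros k; lia|intros; lia].
  - destruct IH as (phi & L & Hphi & HL); [intros; apply HX; lia|].
    destruct (bolzano_weierstrass_extraction (fun k => X (phi k) n) a b)
      as (psi & l & Hpsi & Hl); [intros; apply HX; lia|].
    exists (fun k => phi (psi k)), (fun j => if Nat.eqb j n then l else L j).
    split.
    + intros k. apply extraction_lt; [assumption|apply Hpsi].
    + intros j Hj. destruct (Nat.eqb_spec j n) as [->|]; [exact Hl|].
      apply (Un_cv_extract (fun k => X (phi k) j)); [assumption|apply HL; lia].
Qed.

Lemma Un_cv_sumn n (F : nat -> nat -> R) (G : nat -> R) :
  (forall j, (j < n)%nat -> Un_cv (fun k => F k j) (G j)) ->
  Un_cv (fun k => sumn n (F k)) (sumn n G).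
Proof.
  induction n as [|n IH]; intros H; simpl; [apply Un_cv_const|].
  apply (CV_plus (fun k => sumn n (F k)) (fun k => F k n));
    [apply IH; intros; apply H|apply H]; lia.
Qed.

Lemma Un_cv_prodn n (F : nat -> nat -> R) (G : nat -> R) :
  (forall j, (j < n)%nat -> Un_cv (fun k => F k j) (G j)) ->
  Un_cv (fun k => prodn n (F k)) (prodn n G).
Proof.
  induction n as [|n IH]; intros H; simpl; [apply Un_cv_const|].
  apply (CV_mult (fun k => prodn n (F k)) (fun k => F k n));
    [apply IH; intros; apply H|apply H]; lia.
Qed.

Definition seq_cv (n : nat) (X : nat -> nat -> R) (L : nat -> R) : Prop :=
  forall j, (j < n)%nat -> Un_cv (fun k => X k j) (L j).

(* [atan] turns [F] into a bounded function with the same maximisers, so that the supremum exists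
   before [F] is known to be bounded. *)
Lemma extreme_value n (K : (nat -> R) -> Prop) (F : (nat -> R) -> R) (a b : R) x0 :
  K x0 ->
  (forall x, K x -> forall j, (j < n)%nat -> a <= x j <= b) ->
  (forall X L, (forall k, K (X k)) -> seq_cv n X L -> K L) ->
  (forall X L, seq_cv n X L -> Un_cv (fun k => F (X k)) (F L)) ->
  exists L, K L /\ forall x, K x -> F x <= F L.
Proof.
  intros Hx0 Hbd Hcl Hct.
  set (E := fun v => exists x, K x /\ v = atan (F x)).
  destruct (completeness E) as [M [Mub Mlub]].
  - exists (PI / 2). intros v [x [_ ->]]. pose proof (atan_bound (F x)). lra.
  - exists (atan (F x0)). now exists x0.
  - assert (Hn : forall k : nat, exists x, K x /\ M - / (INR k + 1) <= atan (F x)).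
    { intros k. apply NNPP. intros Hk.
      assert (Hp : 0 < / (INR k + 1)).
      { apply Rinv_0_lt_compat. pose proof (pos_INR k). lra. }
      enough (M <= M - / (INR k + 1)) by lra.
      apply Mlub. intros v [x [Hx ->]].
      apply Rnot_lt_le. intros Hlt. apply Hk. exists x. split; [assumption|lra]. }
    set (X := fun k => proj1_sig (constructive_indefinite_description _ (Hn k))).
    assert (HX : forall k, K (X k) /\ M - / (INR k + 1) <= atan (F (X k))).
    { intros k. apply (proj2_sig (constructive_indefinite_description _ (Hn k))). }
    destruct (bolzano_weierstrass_vector n X a b) as (phi & L & Hphi & HL).
    { intros k j Hj. exact (Hbd _ (proj1 (HX k)) j Hj). }
    assert (KL : K L).
    { apply (Hcl (fun k => X (phi k))); [intros; apply HX|exact HL]. }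
    exists L. split; [exact KL|].
    assert (HM : M <= atan (F L)).
    { apply (@Rle_cv_lim (fun k => M - / (INR (phi k) + 1)) (fun k => atan (F (X (phi k))))).
      - intros k. apply HX.
      - replace M with (M - 0) at 1 by ring.
        apply (CV_minus (fun _ => M) (fun k => / (INR (phi k) + 1))); [apply Un_cv_const|].
        apply (Un_cv_extract (fun k => / (INR k + 1))); [assumption|apply inv_INR_S_cv0].
      - apply (continuity_seq atan (fun k => F (X (phi k)))).
        + apply derivable_continuous_pt, derivable_pt_atan.
        + apply (Hct (fun k => X (phi k)) L HL). }
    intros x Hx. apply Rnot_lt_le. intros Hlt. apply atan_increasing in Hlt.
    assert (atan (F x) <= M) by (apply Mub; now exists x). lra.
Qed.

(** * The barrier function *)

Definition slack (n : nat) (A : nat -> nat -> R) (b : nat -> R) (x : nat -> R) (k : nat) : R :=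
  b k - sumn n (fun j => A k j * x j).

(** The exponential of the logarithmic barrier -c.x/mu + sum ln x_j + sum ln w_k. In product form it
    is continuous on the whole closed polytope and vanishes where a coordinate or slack does, which
    forces its maximiser into the interior. *)
Definition barrier n m A b c mu (x : nat -> R) : R :=
  exp (- (/ mu * sumn n (fun j => c j * x j))) * (prodn n x * prodn m (slack n A b x)).

Lemma slack_cv n A b X L k :
  seq_cv n X L -> Un_cv (fun i => slack n A b (X i) k) (slack n A b L k).
Proof.
  intros H. apply (CV_minus (fun _ => b k) (fun i => sumn n (fun j => A k j * X i j)));
    [apply Un_cv_const|].
  apply (Un_cv_sumn n (fun i j => A k j * X i j)). intros j Hj.
  apply (CV_mult (fun _ => A k j) (fun i => X i j)); [apply Un_cv_const|now apply H].
Qed.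

Lemma barrier_cv n m A b c mu X L :
  seq_cv n X L -> Un_cv (fun i => barrier n m A b c mu (X i)) (barrier n m A b c mu L).
Proof.
  intros H. unfold barrier.
  apply (CV_mult (fun i => exp (- (/ mu * sumn n (fun j => c j * X i j))))
           (fun i => prodn n (X i) * prodn m (slack n A b (X i)))).
  - apply (continuity_seq exp (fun i => - (/ mu * sumn n (fun j => c j * X i j)))).
    + apply derivable_continuous_pt, derivable_pt_exp.
    + apply (CV_opp (fun i => / mu * sumn n (fun j => c j * X i j))).
      apply (CV_mult (fun _ => / mu) (fun i => sumn n (fun j => c j * X i j)));
        [apply Un_cv_const|].
      apply (Un_cv_sumn n (fun i j => c j * X i j)). intros j Hj.
      apply (CV_mult (fun _ => c j) (fun i => X i j)); [apply Un_cv_const|now apply H].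
  - apply (CV_mult (fun i => prodn n (X i)) (fun i => prodn m (slack n A b (X i)))).
    + apply (Un_cv_prodn n X L H).
    + apply (Un_cv_prodn m (fun i => slack n A b (X i))). intros k _. now apply slack_cv.
Qed.

Lemma derivable_pt_lim_sumn n (f : nat -> R -> R) (d : nat -> R) s :
  (forall i, (i < n)%nat -> derivable_pt_lim (f i) s (d i)) ->
  derivable_pt_lim (fun s => sumn n (fun i => f i s)) s (sumn n d).
Proof.
  induction n as [|n IH]; intros H; simpl; [apply derivable_pt_lim_const|].
  apply (derivable_pt_lim_plus (fun s => sumn n (fun i => f i s)) (f n));
    [apply IH; intros; apply H|apply H]; lia.
Qed.

Lemma derivable_pt_lim_affine a d : derivable_pt_lim (fun s => a + s * d) 0 d.
Proof.
  intros eps Heps. exists (mkposreal 1 Rlt_0_1). intros h Hh _.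
  replace ((a + (0 + h) * d - (a + 0 * d)) / h - d) with 0 by (field; assumption).
  now rewrite Rabs_R0.
Qed.

Lemma derivable_pt_lim_ln_affine a d :
  0 < a -> derivable_pt_lim (fun s => ln (a + s * d)) 0 (/ a * d).
Proof.
  intros Ha.
  apply (derivable_pt_lim_comp (fun s => a + s * d) ln).
  - apply derivable_pt_lim_affine.
  - replace (a + 0 * d) with a by ring. now apply derivable_pt_lim_ln.
Qed.

(** Lets an interior point move a little both ways along a line, so that a maximum there is a
    two-sided one. *)
Lemma affine_family_pos m (w d : nat -> R) :
  (forall k, (k < m)%nat -> 0 < w k) ->
  exists del, 0 < del /\ forall s, Rabs s < del -> forall k, (k < m)%nat -> 0 < w k + s * d k.
Proof.
  induction m as [|m IH]; intros H.
  - exists 1. split; [lra|intros; lia].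
  - destruct IH as (e & He & Hs); [intros; apply H; lia|].
    assert (Hw : 0 < w m) by (apply H; lia).
    (* The added 1 keeps the radius [w m / (Rabs (d m) + 1)] meaningful when [d m] is zero. *)
    assert (Hp : 0 < Rabs (d m) + 1) by (pose proof (Rabs_pos (d m)); lra).
    exists (Rmin e (w m / (Rabs (d m) + 1))). split.
    + apply Rmin_glb_lt; [assumption|]. now apply Rdiv_lt_0_compat.
    + intros s Hlt k Hk.
      pose proof (Rmin_l e (w m / (Rabs (d m) + 1))).
      pose proof (Rmin_r e (w m / (Rabs (d m) + 1))).
      destruct (Nat.eq_dec k m) as [->|]; [|apply Hs; lra || lia].
      assert (Hb : Rabs s * (Rabs (d m) + 1) < w m).
      { apply Rmult_lt_reg_r with (/ (Rabs (d m) + 1)); [now apply Rinv_0_lt_compat|].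
        rewrite Rmult_assoc, Rinv_r, Rmult_1_r by lra. unfold Rdiv in *. lra. }
      assert (- (s * d m) <= Rabs s * Rabs (d m)).
      { rewrite <- Rabs_mult, <- Rabs_Ropp. apply Rle_abs. }
      pose proof (Rabs_pos s). nra.
Qed.

(* The maximiser of the barrier over the polytope is interior, and stationarity there is the
   dual feasibility equation for [y = mu / w], [s = mu / x]. *)
Theorem central_path_exists n m A b c mu B x0 :
  0 < mu ->
  (forall x, (forall j, (j < n)%nat -> 0 <= x j) ->
     (forall k, (k < m)%nat -> 0 <= slack n A b x k) ->
     forall j, (j < n)%nat -> x j <= B) ->
  (forall j, (j < n)%nat -> 0 < x0 j) ->
  (forall k, (k < m)%nat -> 0 < slack n A b x0 k) ->
  exists x, (forall j, (j < n)%nat -> 0 < x j) /\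
    (forall k, (k < m)%nat -> 0 < slack n A b x k) /\
    (forall j, (j < n)%nat ->
       c j + sumn m (fun k => A k j * (mu / slack n A b x k)) = mu / x j).
Proof.
  intros Hmu HB Hx0 Hw0.
  set (K := fun x => (forall j, (j < n)%nat -> 0 <= x j) /\
                     (forall k, (k < m)%nat -> 0 <= slack n A b x k)).
  destruct (extreme_value n K (barrier n m A b c mu) 0 B x0) as (x & [Hx Hw] & Hmax).
  - split; intros; left; auto.
  - intros x [H1 H2] j Hj. split; [auto|now apply HB].
  - intros X L HK HX. split.
    + intros j Hj. apply (@Rle_cv_lim (fun _ => 0) (fun k => X k j));
        [intros; now apply HK|apply Un_cv_const|now apply HX].
    + intros k Hk. apply (@Rle_cv_lim (fun _ => 0) (fun i => slack n A b (X i) k));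
        [intros; now apply HK|apply Un_cv_const|now apply slack_cv].
  - intros X L. apply barrier_cv.
  (* The strictly feasible [x0] has a positive barrier value, so the maximum is positive and no
     factor vanishes. *)
  - assert (Hpos : 0 < barrier n m A b c mu x).
    { apply Rlt_le_trans with (barrier n m A b c mu x0).
      - apply Rmult_lt_0_compat; [apply exp_pos|].
        apply Rmult_lt_0_compat; now apply prodn_pos.
      - apply Hmax. split; intros; left; auto. }
    assert (Px : forall j, (j < n)%nat -> 0 < x j).
    { intros j Hj. destruct (Hx j Hj) as [|E]; [assumption|].
      unfold barrier in Hpos. rewrite (prodn_eq0 n x j) in Hpos by auto. lra. }
    assert (Pw : forall k, (k < m)%nat -> 0 < slack n A b x k).
    { intros k Hk. destruct (Hw k Hk) as [|E]; [assumption|].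
      unfold barrier in Hpos. rewrite (prodn_eq0 m (slack n A b x) k) in Hpos by auto. lra. }
    exists x. split; [exact Px|]. split; [exact Pw|]. intros j Hj.
    set (e := fun i => if Nat.eqb i j then 1 else 0).
    set (xs := fun s i => x i + s * e i).
    assert (Hsl : forall s k, slack n A b (xs s) k = slack n A b x k + s * (- A k j)).
    { intros s k. unfold slack, xs.
      rewrite (sumn_ext n _ (fun i => A k i * x i + s * (e i * A k i))) by (intros; ring).
      rewrite sumn_plus, sumn_scal. unfold e. rewrite sumn_delta by assumption. ring. }
    assert (Hcx : forall s, sumn n (fun i => c i * xs s i) = sumn n (fun i => c i * x i) + s * c j).
    { intros s. unfold xs.
      rewrite (sumn_ext n _ (fun i => c i * x i + s * (e i * c i))) by (intros; ring).
      rewrite sumn_plus, sumn_scal. unfold e. rewrite sumn_delta by assumption. ring. }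
    (* The logarithm of the barrier along the line x + s e_j, spelled out in affine arguments so
       that it can be differentiated term by term. *)
    set (g := fun s => (- (/ mu * sumn n (fun i => c i * x i)) + s * (- (/ mu * c j)))
                + (sumn n (fun i => ln (x i + s * e i))
                   + sumn m (fun k => ln (slack n A b x k + s * (- A k j))))).
    assert (Hg : derivable_pt_lim g 0 (- (/ mu * c j) +
              (sumn n (fun i => / x i * e i) + sumn m (fun k => / slack n A b x k * (- A k j))))).
    { unfold g.
      apply (derivable_pt_lim_plus (fun s => - (/ mu * sumn n (fun i => c i * x i)) + s * (- (/ mu * c j)))
        (fun s => sumn n (fun i => ln (x i + s * e i))
                   + sumn m (fun k => ln (slack n A b x k + s * (- A k j))))).
      - apply derivable_pt_lim_affine.
      - apply (derivable_pt_lim_plus (fun s => sumn n (fun i => ln (x i + s * e i)))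
          (fun s => sumn m (fun k => ln (slack n A b x k + s * (- A k j))))).
        + apply (derivable_pt_lim_sumn n (fun i s => ln (x i + s * e i))).
          intros i Hi. apply derivable_pt_lim_ln_affine. auto.
        + apply (derivable_pt_lim_sumn m (fun k s => ln (slack n A b x k + s * (- A k j)))).
          intros k Hk. apply derivable_pt_lim_ln_affine. auto. }
    destruct (affine_family_pos n x e Px) as (d1 & Hd1 & Hn1).
    destruct (affine_family_pos m _ (fun k => - A k j) Pw) as (d2 & Hd2 & Hn2).
    set (d := Rmin d1 d2).
    assert (Hd : 0 < d) by (now apply Rmin_glb_lt).
    assert (Hgb : forall s, Rabs s < d ->
              (forall i, (i < n)%nat -> 0 < xs s i) /\
              (forall k, (k < m)%nat -> 0 < slack n A b (xs s) k) /\
              g s = ln (barrier n m A b c mu (xs s))).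
    { intros s Hs.
      assert (P1 : forall i, (i < n)%nat -> 0 < xs s i).
      { apply Hn1. eapply Rlt_le_trans; [exact Hs|apply Rmin_l]. }
      assert (P2 : forall k, (k < m)%nat -> 0 < slack n A b (xs s) k).
      { intros k Hk. rewrite Hsl. apply (Hn2 s); [|assumption].
        eapply Rlt_le_trans; [exact Hs|apply Rmin_r]. }
      split; [exact P1|]. split; [exact P2|].
      unfold barrier.
      rewrite ln_mult, ln_exp, ln_mult, !ln_prodn, Hcx by
        (auto using prodn_pos, exp_pos, Rmult_lt_0_compat).
      unfold g. rewrite (sumn_ext m (fun k => ln (slack n A b (xs s) k))
                           (fun k => ln (slack n A b x k + s * (- A k j))))
        by (intros; now rewrite Hsl).
      unfold xs. ring. }
    assert (H0 : Rabs 0 < d) by (rewrite Rabs_R0; assumption).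
    assert (Hx0g : barrier n m A b c mu (xs 0) <= barrier n m A b c mu x).
    { apply Hmax. destruct (Hgb 0 H0) as (Q1 & Q2 & _). split; intros; left; auto. }
    assert (Hg0 : g 0 = ln (barrier n m A b c mu x)).
    { unfold g, barrier.
      rewrite ln_mult, ln_exp, ln_mult, !ln_prodn by
        (auto using prodn_pos, exp_pos, Rmult_lt_0_compat).
      rewrite (sumn_ext n (fun i => ln (x i + 0 * e i)) (fun i => ln (x i)))
        by (intros; f_equal; ring).
      rewrite (sumn_ext m (fun k => ln (slack n A b x k + 0 * - A k j))
                 (fun k => ln (slack n A b x k))) by (intros; f_equal; ring).
      ring. }
    assert (Hder : - (/ mu * c j) + (sumn n (fun i => / x i * e i)
                     + sumn m (fun k => / slack n A b x k * (- A k j))) = 0).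
    { pose proof (deriv_maximum g (- d) d 0 (exist _ _ Hg)) as HD.
      apply HD; [lra|lra|]. intros s Hs1 Hs2.
      assert (Hs : Rabs s < d) by (apply Rabs_def1; lra).
      destruct (Hgb s Hs) as (Q1 & Q2 & ->). rewrite Hg0.
      apply ln_le_mono.
      - apply Rmult_lt_0_compat; [apply exp_pos|].
        apply Rmult_lt_0_compat; now apply prodn_pos.
      - apply Hmax. split; intros; left; auto. }
    rewrite (sumn_ext n _ (fun i => e i * / x i)) in Hder by (intros; ring).
    unfold e in Hder. rewrite (sumn_delta n j (fun i => / x i)) in Hder by assumption.
    rewrite (sumn_ext m _ (fun k => - (/ mu) * (A k j * (mu / slack n A b x k)))) in Hder
      by (intros k Hk; specialize (Pw k Hk); field; lra).
    rewrite sumn_scal in Hder. specialize (Px j Hj).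
    set (T := sumn m (fun k => A k j * (mu / slack n A b x k))) in *.
    (* Stationarity of the logarithm, scaled by [mu], is the j-th dual equation. *)
    apply (f_equal (fun z => mu * z)) in Hder.
    replace (mu * (- (/ mu * c j) + (/ x j + - / mu * T))) with (- c j + mu / x j - T) in Hder
      by (field; lra).
    lra.
Qed.

(** * The rows of the linear program *)

Ltac eqb_cases :=
  repeat match goal with
  | |- context [Nat.eqb ?a ?b] => destruct (Nat.eqb_spec a b)
  end; simpl; try lia; try ring.

(** [LP_A] recovers the stage and the kind of a row from the quotient and remainder of [k + 1] by
    3. *)
Lemma row_div3 i c : (c < 3)%nat -> ((3 * i + c) / 3 = i)%nat /\ ((3 * i + c) mod 3 = c)%nat.
Proof.
  intros Hc. split; symmetry.
  - apply Nat.div_unique with c; lia.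
  - apply Nat.mod_unique with i; lia.
Qed.

Section Rows.
Variables (r : nat) (t : R) (x : nat -> R).
Let n := nvar r.
Let row k := sumn n (fun j => LP_A r t k j * x j).

Lemma LP_row_0 : row 0 = x 0%nat.
Proof.
  unfold row. rewrite (sumn_ext n _ (fun j => (if Nat.eqb j 0 then 1 else 0) * x j)).
  - apply sumn_delta. unfold n, nvar. lia.
  - intros j _. reflexivity.
Qed.

Lemma LP_row_1 : row 1 = x 1%nat.
Proof.
  unfold row. rewrite (sumn_ext n _ (fun j => (if Nat.eqb j 1 then 1 else 0) * x j)).
  - apply sumn_delta. unfold n, nvar. lia.
  - intros j _. reflexivity.
Qed.

(** Here and below [i] runs over 0, ..., r - 1 and rows 3i+2, 3i+3, 3i+4 belong to stage i + 1 of
    the program; the shift avoids subtraction on indices. *)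
Lemma LP_row_z i : (i < r)%nat -> row (3 * i + 2) = x (2 * i + 2)%nat - t * x (2 * i)%nat.
Proof.
  intros Hi. unfold row.
  rewrite (sumn_ext n _ (fun j => (if Nat.eqb j (2 * i + 2) then 1 else 0) * x j
             + (- t) * ((if Nat.eqb j (2 * i) then 1 else 0) * x j))).
  - rewrite sumn_plus, sumn_scal, !sumn_delta by (unfold n, nvar; lia). ring.
  - intros j _. unfold LP_A.
    replace (3 * i + 2 + 1)%nat with (3 * (i + 1) + 0)%nat by lia.
    destruct (row_div3 (i + 1) 0) as [-> ->]; [lia|].
    destruct (Nat.eqb_spec (3 * i + 2) 0); [lia|]. destruct (Nat.eqb_spec (3 * i + 2) 1); [lia|].
    eqb_cases.
Qed.

Lemma LP_row_z' i : (i < r)%nat -> row (3 * i + 3) = x (2 * i + 2)%nat - t * x (2 * i + 1)%nat.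
Proof.
  intros Hi. unfold row.
  rewrite (sumn_ext n _ (fun j => (if Nat.eqb j (2 * i + 2) then 1 else 0) * x j
             + (- t) * ((if Nat.eqb j (2 * i + 1) then 1 else 0) * x j))).
  - rewrite sumn_plus, sumn_scal, !sumn_delta by (unfold n, nvar; lia). ring.
  - intros j _. unfold LP_A.
    replace (3 * i + 3 + 1)%nat with (3 * (i + 1) + 1)%nat by lia.
    destruct (row_div3 (i + 1) 1) as [-> ->]; [lia|].
    destruct (Nat.eqb_spec (3 * i + 3) 0); [lia|]. destruct (Nat.eqb_spec (3 * i + 3) 1); [lia|].
    eqb_cases.
Qed.

Lemma LP_row_h i : (i < r)%nat ->
  row (3 * i + 4) = x (2 * i + 3)%nat
                    - Rpower t (1 - / 2 ^ S i) * (x (2 * i)%nat + x (2 * i + 1)%nat).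
Proof.
  intros Hi. unfold row.
  rewrite (sumn_ext n _ (fun j => (if Nat.eqb j (2 * i + 3) then 1 else 0) * x j
             + (- Rpower t (1 - / 2 ^ S i)) * ((if Nat.eqb j (2 * i) then 1 else 0) * x j
                + (if Nat.eqb j (2 * i + 1) then 1 else 0) * x j))).
  - rewrite sumn_plus, sumn_scal, sumn_plus, !sumn_delta by (unfold n, nvar; lia). ring.
  - intros j _. unfold LP_A.
    replace (3 * i + 4 + 1)%nat with (3 * (i + 1) + 2)%nat by lia.
    destruct (row_div3 (i + 1) 2) as [-> ->]; [lia|].
    replace (i + 1)%nat with (S i) by lia.
    destruct (Nat.eqb_spec (3 * i + 4) 0); [lia|]. destruct (Nat.eqb_spec (3 * i + 4) 1); [lia|].
    generalize (Rpower t (1 - / 2 ^ S i)). intros p.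
    eqb_cases.
Qed.
End Rows.

Definition LP_slack (r : nat) (t : R) : (nat -> R) -> nat -> R :=
  slack (nvar r) (LP_A r t) (LP_b t).

Lemma LP_slack_0 r t x : LP_slack r t x 0 = t - x 0%nat.
Proof. unfold LP_slack, slack. rewrite LP_row_0. reflexivity. Qed.

Lemma LP_slack_1 r t x : LP_slack r t x 1 = t ^ 2 - x 1%nat.
Proof. unfold LP_slack, slack. rewrite LP_row_1. reflexivity. Qed.

Lemma LP_b_tail t k : LP_b t (k + 2) = 0.
Proof. rewrite Nat.add_comm. reflexivity. Qed.

Lemma LP_slack_z r t x i :
  (i < r)%nat -> LP_slack r t x (3 * i + 2) = t * x (2 * i)%nat - x (2 * i + 2)%nat.
Proof.
  intros Hi. unfold LP_slack, slack. rewrite LP_row_z by assumption.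
  rewrite LP_b_tail. ring.
Qed.

Lemma LP_slack_z' r t x i :
  (i < r)%nat -> LP_slack r t x (3 * i + 3) = t * x (2 * i + 1)%nat - x (2 * i + 2)%nat.
Proof.
  intros Hi. unfold LP_slack, slack. rewrite LP_row_z' by assumption.
  replace (3 * i + 3)%nat with (3 * i + 1 + 2)%nat by lia. rewrite LP_b_tail. ring.
Qed.

Lemma LP_slack_h r t x i :
  (i < r)%nat ->
  LP_slack r t x (3 * i + 4)
  = Rpower t (1 - / 2 ^ S i) * (x (2 * i)%nat + x (2 * i + 1)%nat) - x (2 * i + 3)%nat.
Proof.
  intros Hi. unfold LP_slack, slack. rewrite LP_row_h by assumption.
  replace (3 * i + 4)%nat with (3 * i + 2 + 2)%nat by lia. rewrite LP_b_tail. ring.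
Qed.

Lemma con_ind r (Q : nat -> Prop) :
  Q 0%nat -> Q 1%nat ->
  (forall i, (i < r)%nat -> Q (3 * i + 2)%nat /\ Q (3 * i + 3)%nat /\ Q (3 * i + 4)%nat) ->
  forall k, (k < ncon r)%nat -> Q k.
Proof.
  intros H0 H1 H k Hk. unfold ncon in Hk.
  destruct k as [|[|k]]; [assumption|assumption|].
  assert (Hi : (k / 3 < r)%nat) by (apply Nat.Div0.div_lt_upper_bound; lia).
  destruct (H (k / 3)%nat Hi) as (A & B & C).
  pose proof (Nat.div_mod_eq k 3). pose proof (Nat.mod_upper_bound k 3).
  destruct (k mod 3)%nat as [|[|[|c]]] eqn:E.
  - replace (S (S k)) with (3 * (k / 3) + 2)%nat by lia. assumption.
  - replace (S (S k)) with (3 * (k / 3) + 3)%nat by lia. assumption.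
  - replace (S (S k)) with (3 * (k / 3) + 4)%nat by lia. assumption.
  - lia.
Qed.

Lemma var_ind r (Q : nat -> Prop) :
  (forall i, (i <= r)%nat -> Q (2 * i)%nat /\ Q (2 * i + 1)%nat) ->
  forall j, (j < nvar r)%nat -> Q j.
Proof.
  intros H j Hj. unfold nvar in Hj.
  assert (Hi : (j / 2 <= r)%nat) by (apply Nat.lt_succ_r, Nat.Div0.div_lt_upper_bound; lia).
  destruct (H _ Hi) as [A B].
  pose proof (Nat.div_mod_eq j 2). pose proof (Nat.mod_upper_bound j 2).
  destruct (j mod 2)%nat as [|[|c]] eqn:E.
  - replace j with (2 * (j / 2))%nat by lia. assumption.
  - replace j with (2 * (j / 2) + 1)%nat by lia. assumption.
  - lia.
Qed.

(** * The tropical central path *)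

Fixpoint trop (l : R) (i : nat) : R * R :=
  match i with
  | O => (1, l)
  | S k => (1 + Rmin (fst (trop l k)) (snd (trop l k)),
            1 - / 2 ^ i + Rmax (fst (trop l k)) (snd (trop l k)))
  end.

Definition tropu l i := fst (trop l i).
Definition tropv l i := snd (trop l i).

Lemma tropu_S l i : tropu l (S i) = 1 + Rmin (tropu l i) (tropv l i).
Proof. reflexivity. Qed.

Lemma tropv_S l i : tropv l (S i) = 1 - / 2 ^ S i + Rmax (tropu l i) (tropv l i).
Proof. reflexivity. Qed.

Lemma inv_pow2_S i : / 2 ^ S i = / 2 ^ i / 2.
Proof. simpl. field. apply pow_nonzero. lra. Qed.

Lemma inv_pow2_bound i : 0 < / 2 ^ i <= 1.
Proof.
  induction i as [|i IH]; [simpl; lra|]. rewrite inv_pow2_S. lra.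
Qed.

Lemma trop_nonneg l i : 0 <= l -> 0 <= tropu l i /\ 0 <= tropv l i.
Proof.
  intros Hl. induction i as [|i [IHu IHv]].
  - unfold tropu, tropv. simpl. lra.
  - rewrite tropu_S, tropv_S. pose proof (inv_pow2_bound (S i)).
    unfold Rmin, Rmax. destruct (Rle_dec (tropu l i) (tropv l i)); lra.
Qed.

(** Since min + max is the plain sum, stage i adds 2 - 2^-i whatever the order of the two. With the
    difference given by [trop_diff_S], this determines both exponents. *)
Lemma trop_sum l i : tropu l i + tropv l i = l + 2 * INR i + / 2 ^ i.
Proof.
  induction i as [|i IH].
  - unfold tropu, tropv. simpl. lra.
  - rewrite tropu_S, tropv_S, S_INR, inv_pow2_S.
    unfold Rmin, Rmax. destruct (Rle_dec (tropu l i) (tropv l i)); lra.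
Qed.

Lemma trop_diff_S l i :
  tropu l (S i) - tropv l (S i) = / 2 ^ S i - Rabs (tropu l i - tropv l i).
Proof.
  rewrite tropu_S, tropv_S. unfold Rmin, Rmax, Rabs.
  destruct (Rle_dec (tropu l i) (tropv l i)), (Rcase_abs (tropu l i - tropv l i)); lra.
Qed.

(* [tropu - tropv] at level [q] is, up to sign, a triangle wave with [2^q] teeth on [0,2]: the
   recursion [trop_diff_S] folds each tooth into two. *)
Lemma trop_absdiff q : forall k s, (k < 2 ^ q)%nat -> 0 <= s <= 1 ->
  let l := 2 * (INR k + s) * / 2 ^ q in
  Rabs (tropu l q - tropv l q) = Rabs (1 - 2 * s) * / 2 ^ q.
Proof.
  induction q as [|q IH]; intros k s Hk Hs l.
  - simpl in Hk. assert (k = 0)%nat as -> by lia.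
    unfold l, tropu, tropv. simpl. replace (/ 1) with 1 by field.
    replace (1 - 2 * (0 + s) * 1) with (1 - 2 * s) by ring. ring.
  - destruct (Nat.Even_or_Odd k) as [[a Ha]|[a Ha]];
      assert (Ha2 : (a < 2 ^ q)%nat) by (simpl in Hk; lia).
    (* Tooth 2a of the finer level is the left half of tooth [a]: position [s] becomes s/2, where 1
       - 2(s/2) is nonnegative. *)
    + assert (El : l = 2 * (INR a + s / 2) * / 2 ^ q).
      { unfold l. rewrite inv_pow2_S, Ha, mult_INR. simpl (INR 2). field.
        apply pow_nonzero. lra. }
      rewrite trop_diff_S. rewrite El at 1 2. rewrite IH by (assumption || lra).
      pose proof (inv_pow2_bound q). rewrite inv_pow2_S.
      rewrite (Rabs_pos_eq (1 - 2 * (s / 2))) by lra.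
      replace (/ 2 ^ q / 2 - (1 - 2 * (s / 2)) * / 2 ^ q)
        with (- ((1 - 2 * s) * (/ 2 ^ q / 2))) by (field; apply pow_nonzero; lra).
      rewrite Rabs_Ropp, Rabs_mult. f_equal. apply Rabs_pos_eq. lra.
    (* Tooth 2a + 1 is the right half of tooth [a], where the sign inside the absolute value is
       reversed. *)
    + assert (El : l = 2 * (INR a + (1 + s) / 2) * / 2 ^ q).
      { unfold l. rewrite inv_pow2_S, Ha, plus_INR, mult_INR. simpl (INR 2). simpl (INR 1).
        field. apply pow_nonzero. lra. }
      rewrite trop_diff_S. rewrite El at 1 2. rewrite IH by (assumption || lra).
      pose proof (inv_pow2_bound q). rewrite inv_pow2_S.
      rewrite (Rabs_left1 (1 - 2 * ((1 + s) / 2))) by lra.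
      replace (/ 2 ^ q / 2 - - (1 - 2 * ((1 + s) / 2)) * / 2 ^ q)
        with ((1 - 2 * s) * (/ 2 ^ q / 2)) by (field; apply pow_nonzero; lra).
      rewrite Rabs_mult. f_equal. apply Rabs_pos_eq. lra.
Qed.

Definition grid (q k : nat) : R := 2 * INR k * / 2 ^ q.

(** One level down, an even [k] is an end of a tooth, where the difference has modulus 2^-q, and an
    odd [k] is a midpoint, where it is zero. Folding once more gives differences of modulus 2^-(q+1)
    with alternating signs, and [trop_sum] then yields the two values. *)
Lemma trop_grid q k : (k <= 2 ^ S q)%nat ->
  let d := / 2 ^ S q in
  let lo := INR (S q) + INR k * d in
  let hi := INR (S q) + (INR k + 1) * d in
  tropu (grid (S q) k) (S q) = (if Nat.even k then lo else hi) /\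
  tropv (grid (S q) k) (S q) = (if Nat.even k then hi else lo).
Proof.
  intros Hk d lo hi.
  assert (HD : tropu (grid (S q) k) (S q) - tropv (grid (S q) k) (S q)
               = if Nat.even k then - d else d).
  { rewrite trop_diff_S.
    destruct (Nat.Even_or_Odd k) as [[a Ha]|[a Ha]].
    - rewrite (proj2 (Nat.even_spec k)) by (exists a; assumption).
      enough (E : Rabs (tropu (grid (S q) k) q - tropv (grid (S q) k) q) = / 2 ^ q).
      { rewrite E. unfold d. rewrite inv_pow2_S. field. apply pow_nonzero; lra. }
      assert (Ha2 : (a <= 2 ^ q)%nat) by (simpl in Hk; lia).
      assert (El : grid (S q) k = 2 * INR a * / 2 ^ q).
      { unfold grid. rewrite inv_pow2_S, Ha, mult_INR. simpl (INR 2). field.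
        apply pow_nonzero. lra. }
      (* The right end lambda = 2 starts no tooth; it is position s = 1 of the last one. *)
      destruct (Nat.eq_dec a (2 ^ q)) as [Eq|Ne].
      + destruct a as [|a]; [pose proof (Nat.pow_nonzero 2 q); lia|].
        rewrite S_INR in El. rewrite El, trop_absdiff by (lia || lra).
        rewrite Rabs_left1 by lra. ring.
      + replace (2 * INR a) with (2 * (INR a + 0)) in El by ring.
        rewrite El, trop_absdiff by (lia || lra).
        rewrite Rabs_pos_eq by lra. ring.
    - assert (Ho : Nat.even k = false).
      { rewrite <- Nat.negb_odd, (proj2 (Nat.odd_spec k)); [reflexivity|exists a; assumption]. }
      rewrite Ho.
      assert (Ha2 : (a < 2 ^ q)%nat) by (simpl in Hk; lia).
      assert (El : grid (S q) k = 2 * (INR a + 1 / 2) * / 2 ^ q).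
      { unfold grid. rewrite inv_pow2_S, Ha, plus_INR, mult_INR. simpl (INR 2). simpl (INR 1).
        field. apply pow_nonzero. lra. }
      rewrite El, trop_absdiff by (lia || lra).
      replace (1 - 2 * (1 / 2)) with 0 by field. rewrite Rabs_R0. unfold d. ring. }
  pose proof (trop_sum (grid (S q) k) (S q)) as HS.
  assert (Hg : grid (S q) k = 2 * (INR k * d)) by (unfold grid, d; ring).
  fold d in HS. rewrite Hg in HS at 3.
  unfold lo, hi. destruct (Nat.even k); lra.
Qed.

Lemma trop_max_mono l i j : (i <= j)%nat ->
  Rmax (tropu l i) (tropv l i) <= Rmax (tropu l j) (tropv l j).
Proof.
  intros H. induction H as [|j _ IH]; [lra|].
  apply Rle_trans with (1 := IH).
  apply Rle_trans with (tropv l (S j)); [|apply Rmax_r].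
  rewrite tropv_S. pose proof (inv_pow2_bound (S j)). lra.
Qed.

(** One stage raises the maximum by at least 1 - 2^-(i+1), hence by 1/2. This keeps the slacks of
    all earlier stages clear of the dominating one. *)
Lemma trop_max_gap l i j : (i < j)%nat ->
  Rmax (tropu l i) (tropv l i) + / 2 <= Rmax (tropu l j) (tropv l j).
Proof.
  intros H. apply Rle_trans with (Rmax (tropu l (S i)) (tropv l (S i)));
    [|now apply trop_max_mono].
  apply Rle_trans with (tropv l (S i)); [|apply Rmax_r].
  rewrite tropv_S, inv_pow2_S. pose proof (inv_pow2_bound i). lra.
Qed.

(** * Upper bounds on feasible points *)

Lemma Rpower_pos t a : 0 < Rpower t a.
Proof. apply exp_pos. Qed.

Lemma Rpower_2 t : 0 < t -> Rpower t 2 = t ^ 2.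
Proof. intros Ht. rewrite <- (Rpower_pow 2) by assumption. reflexivity. Qed.

Lemma Rpower_mult_self t a : 0 < t -> t * Rpower t a = Rpower t (1 + a).
Proof. intros Ht. rewrite Rpower_plus, Rpower_1 by assumption. reflexivity. Qed.

(** The tropical recursion is the constraints read with equality. Each stage at most doubles the
    constant, because u + v is at most twice the maximum. *)
Lemma feasible_upper r t x M l :
  1 <= t -> 1 <= M ->
  (forall j, (j < nvar r)%nat -> 0 <= x j) ->
  (forall k, (k < ncon r)%nat -> 0 <= LP_slack r t x k) ->
  x 1%nat <= M * Rpower t l ->
  forall i, (i <= r)%nat ->
    x (2 * i)%nat <= M * 2 ^ i * Rpower t (tropu l i) /\
    x (2 * i + 1)%nat <= M * 2 ^ i * Rpower t (tropv l i).
Proof.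
  intros Ht HM Hx Hw H1. induction i as [|i IH]; intros Hi.
  - specialize (Hw 0%nat). rewrite LP_slack_0 in Hw. unfold ncon in Hw.
    assert (0 <= t - x 0%nat) by (apply Hw; lia).
    unfold tropu, tropv. simpl. rewrite Rpower_1 by lra. split; [nra|lra].
  - destruct IH as [IHu IHv]; [lia|].
    pose proof (Hw (3 * i + 2)%nat ltac:(unfold ncon; lia)) as Wz.
    pose proof (Hw (3 * i + 3)%nat ltac:(unfold ncon; lia)) as Wz'.
    pose proof (Hw (3 * i + 4)%nat ltac:(unfold ncon; lia)) as Wh.
    rewrite LP_slack_z in Wz by lia. rewrite LP_slack_z' in Wz' by lia.
    rewrite LP_slack_h in Wh by lia.
    replace (2 * S i)%nat with (2 * i + 2)%nat by lia.
    replace (2 * i + 2 + 1)%nat with (2 * i + 3)%nat by lia.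
    assert (HK : 1 <= M * 2 ^ i) by (pose proof (pow_R1_Rle 2 i ltac:(lra)); nra).
    replace (M * 2 ^ S i) with (2 * (M * 2 ^ i)) by (simpl; ring).
    set (K := M * 2 ^ i) in *. rewrite tropu_S, tropv_S. split.
    + apply Rle_trans with (K * Rpower t (1 + Rmin (tropu l i) (tropv l i))).
      * unfold Rmin. destruct (Rle_dec (tropu l i) (tropv l i));
          rewrite <- Rpower_mult_self by lra.
        -- apply (Rmult_le_compat_l t) in IHu; lra.
        -- apply (Rmult_le_compat_l t) in IHv; lra.
      * pose proof (Rpower_pos t (1 + Rmin (tropu l i) (tropv l i))). nra.
    + rewrite Rpower_plus. pose proof (Rpower_pos t (1 - / 2 ^ S i)) as Hp.
      pose proof (Rle_Rpower t _ _ Ht (Rmax_l (tropu l i) (tropv l i))) as Ru.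
      pose proof (Rle_Rpower t _ _ Ht (Rmax_r (tropu l i) (tropv l i))) as Rv.
      set (R0 := Rpower t (Rmax (tropu l i) (tropv l i))) in *.
      assert (x (2 * i)%nat <= K * R0) by (apply Rle_trans with (1 := IHu); nra).
      assert (x (2 * i + 1)%nat <= K * R0) by (apply Rle_trans with (1 := IHv); nra).
      apply Rle_trans with (Rpower t (1 - / 2 ^ S i) * (K * R0 + K * R0)); [|lra].
      apply Rle_trans with (Rpower t (1 - / 2 ^ S i) * (x (2 * i)%nat + x (2 * i + 1)%nat)); [lra|].
      apply Rmult_le_compat_l; lra.
Qed.

(** Each slack is at most the positive part of its constraint, since the subtracted variable is
    nonnegative; the doubling for [h] is absorbed by 2^(i+1) <= 2^r. *)
Lemma feasible_slack_upper r t x M l i :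
  1 <= t -> 1 <= M ->
  (forall j, (j < nvar r)%nat -> 0 <= x j) ->
  (forall k, (k < ncon r)%nat -> 0 <= LP_slack r t x k) ->
  x 1%nat <= M * Rpower t l ->
  (i < r)%nat ->
    LP_slack r t x (3 * i + 2) <= M * 2 ^ r * Rpower t (1 + tropu l i) /\
    LP_slack r t x (3 * i + 3) <= M * 2 ^ r * Rpower t (1 + tropv l i) /\
    LP_slack r t x (3 * i + 4) <= M * 2 ^ r * Rpower t (tropv l (S i)).
Proof.
  intros Ht HM Hx Hw H1 Hi.
  destruct (feasible_upper r t x M l Ht HM Hx Hw H1 i ltac:(lia)) as [Hu Hv].
  rewrite LP_slack_z, LP_slack_z', LP_slack_h by assumption.
  rewrite <- !Rpower_mult_self by lra.
  pose proof (Hx (2 * i + 2)%nat ltac:(unfold nvar; lia)).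
  pose proof (Hx (2 * i + 3)%nat ltac:(unfold nvar; lia)).
  assert (Hp : 2 ^ S i <= 2 ^ r) by (apply Rle_pow; lra || lia). simpl in Hp.
  assert (H2 : 0 < 2 ^ i) by (apply pow_lt; lra).
  assert (HK : 2 * (M * 2 ^ i) <= M * 2 ^ r) by nra.
  assert (HK0 : 0 < M * 2 ^ i) by nra.
  set (K := M * 2 ^ i) in *. set (K' := M * 2 ^ r) in *.
  assert (G : forall a y, 0 <= y -> a <= K * y -> t * a <= K' * (t * y)).
  { intros a y Hy Ha. apply (Rmult_le_compat_l t) in Ha; [|lra].
    assert (0 <= t * y) by nra. nra. }
  split; [|split].
  - pose proof (G _ _ (Rlt_le _ _ (Rpower_pos t _)) Hu). lra.
  - pose proof (G _ _ (Rlt_le _ _ (Rpower_pos t _)) Hv). lra.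
  - rewrite tropv_S, Rpower_plus. pose proof (Rpower_pos t (1 - / 2 ^ S i)) as Hp'.
    pose proof (Rle_Rpower t _ _ Ht (Rmax_l (tropu l i) (tropv l i))) as Ru.
    pose proof (Rle_Rpower t _ _ Ht (Rmax_r (tropu l i) (tropv l i))) as Rv.
    pose proof (Rpower_pos t (Rmax (tropu l i) (tropv l i))) as RR.
    set (R0 := Rpower t (Rmax (tropu l i) (tropv l i))) in *.
    assert (x (2 * i)%nat <= K * R0) by (apply Rle_trans with (1 := Hu); nra).
    assert (x (2 * i + 1)%nat <= K * R0) by (apply Rle_trans with (1 := Hv); nra).
    apply Rle_trans with (Rpower t (1 - / 2 ^ S i) * (K' * R0)); [|lra].
    apply Rle_trans with (Rpower t (1 - / 2 ^ S i) * (x (2 * i)%nat + x (2 * i + 1)%nat)); [lra|].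
    apply Rmult_le_compat_l; [lra|]. nra.
Qed.

(** * A strictly feasible point *)

(** Every coordinate takes half of the largest value that the preceding stage allows, so each slack
    retains at least the other half. Starting from v_0 = mu/2 keeps the cost below mu. The point
    serves twice: as an interior point for existence, and as the comparison point for lower bounds
    on the central path. *)
Fixpoint inner (t mu : R) (i : nat) : R * R :=
  match i with
  | O => (t / 2, mu / 2)
  | S k => (t * Rmin (fst (inner t mu k)) (snd (inner t mu k)) / 2,
            Rpower t (1 - / 2 ^ i) * (fst (inner t mu k) + snd (inner t mu k)) / 2)
  end.

Lemma inner_fst_S t mu i :
  fst (inner t mu (S i)) = t * Rmin (fst (inner t mu i)) (snd (inner t mu i)) / 2.
Proof. reflexivity. Qed.

Lemma inner_snd_S t mu i :
  snd (inner t mu (S i))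
  = Rpower t (1 - / 2 ^ S i) * (fst (inner t mu i) + snd (inner t mu i)) / 2.
Proof. reflexivity. Qed.

Definition inner_point (t mu : R) (j : nat) : R :=
  if Nat.even j then fst (inner t mu (Nat.div2 j)) else snd (inner t mu (Nat.div2 j)).

Lemma inner_point_even t mu i : inner_point t mu (2 * i) = fst (inner t mu i).
Proof.
  unfold inner_point. rewrite Nat.div2_double, Nat.even_mul. reflexivity.
Qed.

Lemma inner_point_odd t mu i : inner_point t mu (2 * i + 1) = snd (inner t mu i).
Proof.
  unfold inner_point. rewrite Nat.add_1_r, Nat.div2_succ_double, Nat.even_succ, Nat.odd_mul.
  reflexivity.
Qed.

Lemma inner_lower t l i : 1 <= t ->
  / 2 ^ S i * Rpower t (tropu l i) <= fst (inner t (Rpower t l) i) /\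
  / 2 ^ S i * Rpower t (tropv l i) <= snd (inner t (Rpower t l) i).
Proof.
  intros Ht. induction i as [|i [IHu IHv]].
  - unfold tropu, tropv. simpl. rewrite Rpower_1 by lra. lra.
  - rewrite tropu_S, tropv_S, <- Rpower_mult_self by lra. rewrite Rpower_plus.
    rewrite (inv_pow2_S (S i)), inner_fst_S, inner_snd_S.
    pose proof (inv_pow2_bound (S i)) as [Hc _].
    set (c := / 2 ^ S i) in *.
    set (u := fst (inner t (Rpower t l) i)) in *.
    set (v := snd (inner t (Rpower t l) i)) in *.
    pose proof (Rpower_pos t (tropu l i)). pose proof (Rpower_pos t (tropv l i)).
    split.
    + enough (c * Rpower t (Rmin (tropu l i) (tropv l i)) <= Rmin u v).
      { apply (Rmult_le_compat_l t) in H1; lra. }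
      pose proof (Rle_Rpower t _ _ Ht (Rmin_l (tropu l i) (tropv l i))).
      pose proof (Rle_Rpower t _ _ Ht (Rmin_r (tropu l i) (tropv l i))).
      apply Rmin_glb; nra.
    + enough (c * Rpower t (Rmax (tropu l i) (tropv l i)) <= u + v).
      { apply (Rmult_le_compat_l (Rpower t (1 - c))) in H1; [lra|].
        left. apply Rpower_pos. }
      unfold Rmax. destruct (Rle_dec (tropu l i) (tropv l i)); nra.
Qed.

Lemma Rpower_ge_1 t a : 1 <= t -> 0 <= a -> 1 <= Rpower t a.
Proof.
  intros Ht Ha. rewrite <- (Rpower_O t) by lra. now apply Rle_Rpower.
Qed.

(** The slack of an [h] row equals the coordinate v_(i+1) itself; the [z] and [z'] slacks lose at
    most half of t u_i and t v_i, as the minimum is below both. *)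
Lemma inner_slack_lower r t l i : 1 <= t -> (i < r)%nat ->
  let w := LP_slack r t (inner_point t (Rpower t l)) in
  / 2 ^ S (S i) * Rpower t (1 + tropu l i) <= w (3 * i + 2)%nat /\
  / 2 ^ S (S i) * Rpower t (1 + tropv l i) <= w (3 * i + 3)%nat /\
  / 2 ^ S (S i) * Rpower t (tropv l (S i)) <= w (3 * i + 4)%nat.
Proof.
  intros Ht Hi w. unfold w. rewrite LP_slack_z, LP_slack_z', LP_slack_h by assumption.
  replace (2 * i + 2)%nat with (2 * S i)%nat by lia.
  replace (2 * i + 3)%nat with (2 * S i + 1)%nat by lia.
  rewrite !inner_point_odd, !inner_point_even.
  destruct (inner_lower t l i Ht) as [Hu Hv].
  destruct (inner_lower t l (S i) Ht) as [_ Hh].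
  rewrite <- !Rpower_mult_self by lra. rewrite (inv_pow2_S (S i)) in *.
  rewrite inner_fst_S. rewrite inner_snd_S in *.
  set (c := / 2 ^ S i) in *.
  set (u := fst (inner t (Rpower t l) i)) in *.
  set (v := snd (inner t (Rpower t l) i)) in *.
  pose proof (Rmin_l u v). pose proof (Rmin_r u v).
  split; [|split].
  - apply (Rmult_le_compat_l t) in Hu; [|lra]. apply (Rmult_le_compat_l t) in H; lra.
  - apply (Rmult_le_compat_l t) in Hv; [|lra]. apply (Rmult_le_compat_l t) in H0; lra.
  - lra.
Qed.

(** All tropical exponents are nonnegative here, so the powers of [t] are at least 1 and the bound
    is uniform in [t] and lambda. The limit lambda <= 2 serves h_0 = t^2 - mu/2. *)
Lemma inner_point_bounds r t l : 1 <= t -> 0 <= l <= 2 ->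
  (forall j, (j < nvar r)%nat -> / 2 ^ S r <= inner_point t (Rpower t l) j) /\
  (forall k, (k < ncon r)%nat -> / 2 ^ S r <= LP_slack r t (inner_point t (Rpower t l)) k).
Proof.
  intros Ht Hl.
  assert (Hc : forall i, (i <= r)%nat -> / 2 ^ S r <= / 2 ^ S i).
  { intros i Hi. apply Rinv_le_contravar; [apply pow_lt; lra|]. apply Rle_pow; [lra|lia]. }
  assert (G : forall i a, (i <= r)%nat -> 0 <= a -> / 2 ^ S r <= / 2 ^ S i * Rpower t a).
  { intros i a Hi Ha. specialize (Hc i Hi). pose proof (Rpower_ge_1 t a Ht Ha).
    pose proof (inv_pow2_bound (S i)). nra. }
  split.
  - apply var_ind. intros i Hi. destruct (inner_lower t l i Ht) as [Hu Hv].
    destruct (trop_nonneg l i ltac:(lra)) as [Tu Tv].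
    rewrite inner_point_even, inner_point_odd.
    split; [apply Rle_trans with (2 := Hu)|apply Rle_trans with (2 := Hv)]; now apply G.
  - assert (H0 : / 2 ^ S r <= / 2) by (specialize (Hc 0%nat ltac:(lia)); simpl in *; lra).
    apply con_ind.
    + rewrite LP_slack_0. change (inner_point t (Rpower t l) 0) with (t / 2). lra.
    + rewrite LP_slack_1. change (inner_point t (Rpower t l) 1) with (Rpower t l / 2).
      pose proof (Rle_Rpower t l 2 Ht ltac:(lra)) as Hp.
      rewrite Rpower_2 in Hp by lra.
      assert (1 <= t ^ 2) by nra. lra.
    + intros i Hi. destruct (inner_slack_lower r t l i Ht Hi) as (A & B & C).
      destruct (trop_nonneg l i ltac:(lra)) as [Tu Tv].
      destruct (trop_nonneg l (S i) ltac:(lra)) as [_ Tv'].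
      split; [apply Rle_trans with (2 := A)|split;
        [apply Rle_trans with (2 := B)|apply Rle_trans with (2 := C)]];
        apply G; lia || lra.
Qed.

(** * Points of the central path *)

(** The two double sums in [A] cancel. It is stated for an arbitrary [x] so as to apply to the
    central point and also to a comparison point paired with the central dual. *)
Lemma duality_identity n m A b c x y s :
  (forall j, (j < n)%nat -> s j = c j + sumn m (fun k => A k j * y k)) ->
  sumn n (fun j => x j * s j) + sumn m (fun k => slack n A b x k * y k)
  = sumn n (fun j => c j * x j) + sumn m (fun k => b k * y k).
Proof.
  intros Hs.
  rewrite (sumn_ext n _ (fun j => c j * x j + sumn m (fun k => x j * (A k j * y k)))).
  2:{ intros j Hj. rewrite Hs by assumption. rewrite sumn_scal. ring. }
  rewrite sumn_plus, sumn_exchange.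
  rewrite (sumn_ext m (fun k => slack n A b x k * y k)
             (fun k => b k * y k + (-1) * sumn n (fun j => x j * (A k j * y k)))).
  - rewrite sumn_plus, sumn_scal. ring.
  - intros k _. unfold slack.
    rewrite (sumn_ext n (fun j => x j * (A k j * y k)) (fun j => y k * (A k j * x j)))
      by (intros; ring).
    rewrite sumn_scal. ring.
Qed.

Section CentralPoint.
Variables (n m : nat) (A : nat -> nat -> R) (b c : nat -> R) (mu : R) (x y s : nat -> R).
Hypothesis Hmu : 0 < mu.
Hypothesis Hs : forall j, (j < n)%nat -> s j = c j + sumn m (fun k => A k j * y k).
Hypothesis Hxs : forall j, (j < n)%nat -> x j * s j = mu /\ 0 < x j.
Hypothesis Hwy : forall k, (k < m)%nat -> slack n A b x k * y k = mu /\ 0 < slack n A b x k.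
Hypothesis Hcx : 0 <= sumn n (fun j => c j * x j).
Hypothesis Hby : 0 <= sumn m (fun k => b k * y k).

Lemma central_gap :
  INR (n + m) * mu = sumn n (fun j => c j * x j) + sumn m (fun k => b k * y k).
Proof.
  rewrite <- (duality_identity n m A b c x y s Hs).
  rewrite (sumn_ext n _ (fun _ => mu)) by (intros; now apply Hxs).
  rewrite (sumn_ext m _ (fun _ => mu)) by (intros; now apply Hwy).
  rewrite !sumn_const, plus_INR. ring.
Qed.

Lemma central_cost_le : sumn n (fun j => c j * x j) <= INR (n + m) * mu.
Proof. rewrite central_gap. lra. Qed.

(** Pair [z] with the central dual: the nonnegative terms z_j s_j and w_k(z) y_k add up to c.z +
    b.y, at most mu + (n+m) mu. Each term obeys this bound, and s_j = mu/x_j, y_k = mu/w_k turn it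
    into the claim. *)
Lemma central_dominates z :
  (forall j, (j < n)%nat -> 0 <= z j) ->
  (forall k, (k < m)%nat -> 0 <= slack n A b z k) ->
  sumn n (fun j => c j * z j) <= mu ->
  (forall j, (j < n)%nat -> z j <= (INR (n + m) + 1) * x j) /\
  (forall k, (k < m)%nat -> slack n A b z k <= (INR (n + m) + 1) * slack n A b x k).
Proof.
  intros Hz Hw Hc.
  pose proof (duality_identity n m A b c z y s Hs) as Hid.
  pose proof central_gap as Hg.
  assert (Ps : forall j, (j < n)%nat -> 0 < s j).
  { intros j Hj. destruct (Hxs j Hj). apply Rmult_lt_reg_l with (x j); lra. }
  assert (Py : forall k, (k < m)%nat -> 0 < y k).
  { intros k Hk. destruct (Hwy k Hk). apply Rmult_lt_reg_l with (slack n A b x k); lra. }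
  assert (N1 : forall j, (j < n)%nat -> 0 <= z j * s j).
  { intros j Hj. specialize (Hz j Hj). specialize (Ps j Hj). nra. }
  assert (N2 : forall k, (k < m)%nat -> 0 <= slack n A b z k * y k).
  { intros k Hk. specialize (Hw k Hk). specialize (Py k Hk). nra. }
  pose proof (sumn_nonneg n _ N1). pose proof (sumn_nonneg m _ N2).
  split.
  - intros j Hj. pose proof (sumn_term_le n _ j N1 Hj). simpl in *.
    destruct (Hxs j Hj). specialize (Ps j Hj).
    apply Rmult_le_reg_r with (s j); [assumption|]. rewrite Rmult_assoc, H2. lra.
  - intros k Hk. pose proof (sumn_term_le m _ k N2 Hk). simpl in *.
    destruct (Hwy k Hk). specialize (Py k Hk).
    apply Rmult_le_reg_r with (y k); [assumption|]. rewrite Rmult_assoc, H2. lra.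
Qed.
End CentralPoint.

Lemma LP_cost n x : (1 < n)%nat -> sumn n (fun j => LP_c j * x j) = x 1%nat.
Proof. intros Hn. unfold LP_c. now apply sumn_delta. Qed.

(** The constraint on h_0 bounds v_0 by t^2, which is the case lambda = 2 of [feasible_upper]. *)
Lemma feasible_bounded r t : 1 <= t -> exists B, forall x,
  (forall j, (j < nvar r)%nat -> 0 <= x j) ->
  (forall k, (k < ncon r)%nat -> 0 <= LP_slack r t x k) ->
  forall j, (j < nvar r)%nat -> x j <= B.
Proof.
  intros Ht.
  set (M := Rmax (tropu 2 r) (tropv 2 r)).
  exists (2 ^ r * Rpower t M). intros x Hx Hw. apply var_ind. intros i Hi.
  assert (H1 : x 1%nat <= 1 * Rpower t 2).
  { rewrite Rpower_2 by lra. pose proof (Hw 1%nat ltac:(unfold ncon; lia)) as H.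
    rewrite LP_slack_1 in H. lra. }
  destruct (feasible_upper r t x 1 2 Ht ltac:(lra) Hx Hw H1 i Hi) as [Hu Hv].
  assert (Hp : 0 < 2 ^ i <= 2 ^ r).
  { split; [apply pow_lt|apply Rle_pow]; lra || lia. }
  pose proof (trop_max_mono 2 i r Hi) as Hm. fold M in Hm.
  pose proof (Rmax_l (tropu 2 i) (tropv 2 i)). pose proof (Rmax_r (tropu 2 i) (tropv 2 i)).
  split.
  - apply Rle_trans with (1 := Hu). rewrite Rmult_1_l.
    apply Rmult_le_compat; try lra; [left; apply Rpower_pos|apply Rle_Rpower; lra].
  - apply Rle_trans with (1 := Hv). rewrite Rmult_1_l.
    apply Rmult_le_compat; try lra; [left; apply Rpower_pos|apply Rle_Rpower; lra].
Qed.

Lemma central_point_exists r t l : 1 <= t -> 0 <= l <= 2 ->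
  exists P, is_central_point r t (Rpower t l) P.
Proof.
  intros Ht Hl.
  destruct (feasible_bounded r t Ht) as [B HB].
  destruct (inner_point_bounds r t l Ht Hl) as [Hx0 Hw0].
  destruct (inv_pow2_bound (S r)) as [Hc _].
  destruct (central_path_exists (nvar r) (ncon r) (LP_A r t) (LP_b t) LP_c (Rpower t l) B
              (inner_point t (Rpower t l))) as (x & Hx & Hw & Hs).
  - apply Rpower_pos.
  - exact HB.
  - intros j Hj. specialize (Hx0 j Hj). lra.
  - intros k Hk. specialize (Hw0 k Hk). unfold LP_slack in Hw0. lra.
  - set (n := nvar r) in *. set (m := ncon r) in *. set (mu := Rpower t l) in *.
    set (w := slack n (LP_A r t) (LP_b t) x) in *.
    pose (P := fun i => if Nat.ltb i n then x i
                        else if Nat.ltb i (n + m) then w (i - n)%nat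
                        else if Nat.ltb i (n + 2 * m) then mu / w (i - n - m)%nat
                        else mu / x (i - n - 2 * m)%nat).
    assert (Hmu : 0 < mu) by apply Rpower_pos.
    assert (P1 : forall j, (j < n)%nat -> P j = x j).
    { intros j Hj. unfold P. destruct (Nat.ltb_spec j n); [reflexivity|lia]. }
    assert (P2 : forall k, (k < m)%nat -> P (n + k)%nat = w k).
    { intros k Hk. unfold P. destruct (Nat.ltb_spec (n + k) n); [lia|].
      destruct (Nat.ltb_spec (n + k) (n + m)); [f_equal; lia|lia]. }
    assert (P3 : forall k, (k < m)%nat -> P (n + m + k)%nat = mu / w k).
    { intros k Hk. unfold P. destruct (Nat.ltb_spec (n + m + k) n); [lia|].
      destruct (Nat.ltb_spec (n + m + k) (n + m)); [lia|].
      destruct (Nat.ltb_spec (n + m + k) (n + 2 * m)); [do 2 f_equal; lia|lia]. }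
    assert (P4 : forall j, (j < n)%nat -> P (n + 2 * m + j)%nat = mu / x j).
    { intros j Hj. unfold P. destruct (Nat.ltb_spec (n + 2 * m + j) n); [lia|].
      destruct (Nat.ltb_spec (n + 2 * m + j) (n + m)); [lia|].
      destruct (Nat.ltb_spec (n + 2 * m + j) (n + 2 * m)); [lia|do 2 f_equal; lia]. }
    exists P. unfold is_central_point. fold n m mu. split.
    + intros k Hk. rewrite (P2 k Hk), (P3 k Hk). specialize (Hw k Hk).
      rewrite (sumn_ext n _ (fun j => LP_A r t k j * x j)) by (intros; now rewrite P1).
      repeat split.
      * unfold w, slack. ring.
      * field. lra.
      * assumption.
      * now apply Rdiv_lt_0_compat.
    + intros j Hj. rewrite (P1 j Hj), (P4 j Hj). specialize (Hx j Hj).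
      rewrite (sumn_ext m _ (fun k => LP_A r t k j * (mu / w k))) by (intros; now rewrite P3).
      repeat split.
      * rewrite <- Hs by assumption. ring.
      * field. lra.
      * assumption.
      * now apply Rdiv_lt_0_compat.
Qed.

Lemma C_path_central r t l : 1 <= t -> 0 <= l <= 2 ->
  is_central_point r t (Rpower t l) (C_path r t l).
Proof.
  intros Ht Hl. unfold C_path, central_point. apply epsilon_spec.
  now apply central_point_exists.
Qed.

(** Slacks and dual coordinates are expressed through the decision variables, so that only primal
    estimates remain. *)
Lemma LP_central_facts r t mu P : 0 <= t -> 0 < mu -> is_central_point r t mu P ->
  let n := nvar r in let m := ncon r in let N := INR (n + m) in
  (forall j, (j < n)%nat -> 0 < P j /\ P (n + 2 * m + j)%nat = mu / P j) /\
  (forall k, (k < m)%nat -> P (n + k)%nat = LP_slack r t P k /\ 0 < LP_slack r t P k /\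
                            P (n + m + k)%nat = mu / P (n + k)%nat) /\
  P 1%nat <= N * mu /\
  (forall z, (forall j, (j < n)%nat -> 0 <= z j) ->
     (forall k, (k < m)%nat -> 0 <= LP_slack r t z k) -> z 1%nat <= mu ->
     (forall j, (j < n)%nat -> z j <= (N + 1) * P j) /\
     (forall k, (k < m)%nat -> LP_slack r t z k <= (N + 1) * LP_slack r t P k)).
Proof.
  intros Ht Hmu [H1 H2] n m N. fold n m in H1, H2.
  assert (Hw : forall k, (k < m)%nat -> P (n + k)%nat = LP_slack r t P k).
  { intros k Hk. destruct (H1 k Hk) as [E _]. unfold LP_slack, slack. fold n. lra. }
  assert (Hn : (1 < n)%nat) by (unfold n, nvar; lia).
  pose (y := fun k => P (n + m + k)%nat). pose (s := fun j => P (n + 2 * m + j)%nat).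
  assert (Hs : forall j, (j < n)%nat -> s j = LP_c j + sumn m (fun k => LP_A r t k j * y k)).
  { intros j Hj. destruct (H2 j Hj) as [E _]. unfold s, y. lra. }
  assert (Hxs : forall j, (j < n)%nat -> P j * s j = mu /\ 0 < P j).
  { intros j Hj. destruct (H2 j Hj) as (_ & E & A & _). split; assumption. }
  assert (Hwy : forall k, (k < m)%nat ->
            slack n (LP_A r t) (LP_b t) P k * y k = mu /\ 0 < slack n (LP_A r t) (LP_b t) P k).
  { intros k Hk. fold (LP_slack r t P k). destruct (H1 k Hk) as (_ & E & A & _).
    change (LP_slack r t P k * y k = mu /\ 0 < LP_slack r t P k).
    rewrite <- Hw by assumption. split; assumption. }
  assert (Hcx : 0 <= sumn n (fun j => LP_c j * P j)).
  { rewrite LP_cost by assumption. left. now apply Hxs. }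
  assert (Hby : 0 <= sumn m (fun k => LP_b t k * y k)).
  { apply sumn_nonneg. intros k Hk. destruct (H1 k Hk) as (_ & _ & _ & Py). fold (y k) in Py.
    apply Rmult_le_pos; [|lra]. unfold LP_b.
    destruct (Nat.eqb k 0); [assumption|]. destruct (Nat.eqb k 1); [nra|lra]. }
  split; [|split; [|split]].
  - intros j Hj. destruct (Hxs j Hj) as [E Px]. split; [assumption|].
    rewrite <- E. unfold s. field. lra.
  - intros k Hk. destruct (H1 k Hk) as (_ & E & Pw & _).
    rewrite <- Hw by assumption. repeat split; [assumption|]. rewrite <- E. field. lra.
  - rewrite <- (LP_cost n P Hn). apply (central_cost_le n m (LP_A r t) (LP_b t) LP_c mu P y s); assumption.
  - intros z Hz Hwz Hz1. apply (central_dominates n m (LP_A r t) (LP_b t) LP_c mu P y s); try assumption.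
    now rewrite LP_cost.
Qed.

(* The coordinate that dominates at [grid q k], where [r = q + 1]: the slack [z_r] for odd [k],
   [z'_r] for even [k]. *)
Definition top_index (q k : nat) : nat :=
  (nvar (S q) + (if Nat.even k then 3 * q + 3 else 3 * q + 2))%nat.

(** This is 1 + max(u_q, v_q) at [grid q k]: the factor [t] of the slack adds the 1. *)
Definition top_exp (q k : nat) : R := 1 + INR q + (INR k + 1) * / 2 ^ q.

(** The loss n+m+1 from [central_dominates] times the loss 2^(r+1) from the comparison point; it
    also exceeds the factor (n+m) 2^r of the upper bounds. *)
Definition spread (r : nat) : R := (INR (nvar r + ncon r) + 1) * 2 ^ S r.

Lemma spread_ge r : 1 <= INR (nvar r + ncon r) /\ 1 <= 2 ^ r /\
  1 <= spread r /\ INR (nvar r + ncon r) * 2 ^ r <= spread r.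
Proof.
  assert (1 <= INR (nvar r + ncon r)).
  { change 1 with (INR 1). apply le_INR. unfold nvar. lia. }
  assert (1 <= 2 ^ r) by (apply pow_R1_Rle; lra).
  unfold spread. rewrite <- tech_pow_Rmult. repeat split; nra.
Qed.

Lemma grid_range q k : (k <= 2 ^ q)%nat -> 0 <= grid q k <= 2.
Proof.
  intros Hk. apply le_INR in Hk. rewrite pow_INR in Hk. simpl (INR 2) in Hk.
  pose proof (pos_INR k). pose proof (inv_pow2_bound q).
  change (1 + 1) with 2 in Hk.
  assert (H1 : INR k * / 2 ^ q <= 2 ^ q * / 2 ^ q) by (apply Rmult_le_compat_r; lra).
  rewrite Rinv_r in H1 by (apply pow_nonzero; lra).
  unfold grid. nra.
Qed.

Lemma central_dominant_coordinate q k t P : (1 <= q)%nat -> (k <= 2 ^ q)%nat -> 1 <= t ->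
  is_central_point (S q) t (Rpower t (grid q k)) P ->
  / spread (S q) * Rpower t (top_exp q k) <= P (top_index q k) <=
    spread (S q) * Rpower t (top_exp q k) /\
  forall i, (i < pd_dim (S q))%nat -> 0 < P i /\
    (i <> top_index q k ->
     P i <= spread (S q) * Rpower t (top_exp q k - / 2 ^ q / 2)).
Proof.
  intros Hq Hk Ht HP.
  set (r := S q) in *. set (l := grid q k) in *. set (E := top_exp q k).
  set (d := / 2 ^ q). set (C := spread r).
  pose proof (grid_range q k Hk) as Hl. fold l in Hl.
  pose proof (inv_pow2_bound q) as Hd. fold d in Hd.
  assert (Hd2 : d <= / 2).
  { unfold d. destruct q as [|q']; [lia|]. rewrite inv_pow2_S.
    pose proof (inv_pow2_bound q'). lra. }
  destruct (LP_central_facts r t (Rpower t l) P ltac:(lra) (Rpower_pos t l) HP)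
    as (Fx & Fw & F1 & Fz).
  set (n := nvar r) in *. set (m := ncon r) in *. set (N := INR (n + m)) in *.
  destruct (spread_ge r) as (HN & H2r & HC1 & HNC). fold n m N in HN, HNC. fold C in HC1, HNC.
  assert (HC0 : 0 < / C) by (apply Rinv_0_lt_compat; lra).
  assert (HCdef : / C = / (N + 1) * / 2 ^ S r).
  { unfold C, spread. fold n m N. apply Rinv_mult. }
  destruct (inner_point_bounds r t l Ht Hl) as [Zx Zw]. fold n in Zx. fold m in Zw.
  destruct (inv_pow2_bound (S r)) as [Hc _].
  destruct (Fz (inner_point t (Rpower t l))) as [Dx Dw].
  { intros j Hj. specialize (Zx j Hj). lra. }
  { intros j Hj. specialize (Zw j Hj). lra. }
  { change (Rpower t l / 2 <= Rpower t l). pose proof (Rpower_pos t l). lra. }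
  (* Turns a lower bound on the comparison point into one on the central point. *)
  assert (Hdiv : forall a z v, / 2 ^ S r * a <= z -> z <= (N + 1) * v -> / C * a <= v).
  { intros a z v H H'. rewrite HCdef, Rmult_assoc.
    apply Rmult_le_reg_l with (N + 1); [lra|].
    rewrite <- Rmult_assoc, Rinv_r by lra. lra. }
  assert (Px : forall j, (j < n)%nat -> 0 <= P j) by (intros j Hj; left; now apply Fx).
  assert (Pw : forall k, (k < m)%nat -> 0 <= LP_slack r t P k)
    by (intros i Hi; left; now apply Fw).
  set (M := Rmax (tropu l q) (tropv l q)).
  assert (HM : E = 1 + M /\ (if Nat.even k then tropv l q = M /\ tropu l q = M - d
                             else tropu l q = M /\ tropv l q = M - d)).
  { unfold E, top_exp, M, l. destruct q as [|q']; [lia|].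
    destruct (trop_grid q' k Hk) as [-> ->]. unfold d in *.
    destruct (Nat.even k); [rewrite Rmax_right by lra|rewrite Rmax_left by lra];
      repeat split; ring. }
  destruct HM as [HE HM].
  (* Exponent [l] is for the dual coordinates, 2 for the slack h_0. Both fit because q >= 1 gives E
     - d/2 >= 2. *)
  assert (HEl : l <= E - d / 2 /\ 2 <= E - d / 2).
  { unfold E, top_exp. fold d. assert (Hkd : l = 2 * (INR k * d)) by (unfold l, grid, d; ring).
    assert (1 <= INR q) by (change 1 with (INR 1); now apply le_INR).
    pose proof (pos_INR k). nra. }
  assert (HMi : forall i, (i < q)%nat -> tropu l i <= M - / 2 /\ tropv l i <= M - / 2).
  { intros i Hi. pose proof (trop_max_gap l i q Hi) as G. fold M in G.
    pose proof (Rmax_l (tropu l i) (tropv l i)). pose proof (Rmax_r (tropu l i) (tropv l i)).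
    lra. }
  assert (HMq : tropu l q <= M /\ tropv l q <= M) by (split; [apply Rmax_l|apply Rmax_r]).
  (* The margin is sharp at stage [r]: v_r has exponent 1 - d/2 + M = E - d/2, while u_r only
     reaches E - d. *)
  assert (HMr : tropu l r <= E - d / 2 /\ tropv l r <= E - d / 2).
  { unfold r. rewrite tropu_S, tropv_S, inv_pow2_S. fold M d.
    assert (Rmin (tropu l q) (tropv l q) <= M - d).
    { destruct (Nat.even k); destruct HM as [_ <-]; [apply Rmin_l|apply Rmin_r]. }
    lra. }
  assert (HMall : forall i, (i <= r)%nat -> tropu l i <= E - d / 2 /\ tropv l i <= E - d / 2).
  { intros i Hi. destruct (Nat.eq_dec i r) as [->|]; [assumption|].
    destruct (Nat.eq_dec i q) as [->|]; [lra|]. specialize (HMi i ltac:(lia)). lra. }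
  assert (Hup : forall K a z, 0 <= K -> K <= C -> a <= E - d / 2 -> z <= K * Rpower t a ->
                  z <= C * Rpower t (E - d / 2)).
  { intros K a z HK HKC Ha Hz. apply Rle_trans with (1 := Hz).
    apply Rmult_le_compat; try assumption; [left; apply Rpower_pos|now apply Rle_Rpower]. }
  assert (Hpow : forall i, (i <= r)%nat -> 0 <= N * 2 ^ i <= C).
  { intros i Hi. assert (0 < 2 ^ i <= 2 ^ r).
    { split; [apply pow_lt|apply Rle_pow]; lra || lia. }
    split; nra. }
  assert (Ux : forall j, (j < n)%nat -> P j <= C * Rpower t (E - d / 2)).
  { apply var_ind. intros i Hi.
    destruct (feasible_upper r t P N l Ht HN Px Pw F1 i Hi) as [A B].
    destruct (HMall i Hi). specialize (Hpow i Hi).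
    split; [apply Hup with (4 := A)|apply Hup with (4 := B)]; lra. }
  assert (Uw : forall k', (k' < m)%nat -> (n + k')%nat <> top_index q k ->
                 LP_slack r t P k' <= C * Rpower t (E - d / 2)).
  { apply (con_ind r (fun k' => (n + k')%nat <> top_index q k ->
                 LP_slack r t P k' <= C * Rpower t (E - d / 2))).
    - intros _. apply (Hup 1 1); try lra. rewrite LP_slack_0, Rpower_1 by lra.
      specialize (Px 0%nat ltac:(unfold n, nvar; lia)). lra.
    - intros _. apply (Hup 1 2); try lra. rewrite LP_slack_1, Rpower_2 by lra.
      specialize (Px 1%nat ltac:(unfold n, nvar; lia)). lra.
    - intros i Hi.
      destruct (feasible_slack_upper r t P N l i Ht HN Px Pw F1 Hi) as (A & B & D).
      specialize (Hpow r ltac:(lia)).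
      assert (Hi' : (i < q)%nat \/ i = q) by (unfold r in Hi; lia).
      destruct (HMall (S i) ltac:(lia)) as [_ HS].
      split; [|split]; intros Hne.
      + apply Hup with (4 := A); try lra.
        destruct Hi' as [Hi'| ->]; [specialize (HMi i Hi'); lra|].
        unfold top_index in Hne. fold r n in Hne.
        destruct (Nat.even k); [lra|now elim Hne].
      + apply Hup with (4 := B); try lra.
        destruct Hi' as [Hi'| ->]; [specialize (HMi i Hi'); lra|].
        unfold top_index in Hne. fold r n in Hne.
        destruct (Nat.even k); [now elim Hne|lra].
      + apply Hup with (4 := D); lra. }
  assert (Hinv : forall v, / C <= v -> Rpower t l / v <= C * Rpower t (E - d / 2)).
  { intros v Hv. pose proof (Rpower_pos t l).
    apply Hup with (K := C) (a := l); try lra.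
    unfold Rdiv. rewrite Rmult_comm. apply Rmult_le_compat_r; [lra|].
    rewrite <- (Rinv_inv C). apply Rinv_le_contravar; lra. }
  assert (Lx : forall j, (j < n)%nat -> / C <= P j).
  { intros j Hj. rewrite <- (Rmult_1_r (/ C)).
    apply (Hdiv 1 _ _) with (2 := Dx j Hj). rewrite Rmult_1_r. now apply Zx. }
  assert (Lw : forall k', (k' < m)%nat -> / C <= LP_slack r t P k').
  { intros j Hj. rewrite <- (Rmult_1_r (/ C)).
    apply (Hdiv 1 _ _) with (2 := Dw j Hj). rewrite Rmult_1_r. now apply Zw. }
  split.
  - destruct (inner_slack_lower r t l q Ht ltac:(unfold r; lia)) as (A & B & _).
    destruct (feasible_slack_upper r t P N l q Ht HN Px Pw F1 ltac:(unfold r; lia))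
      as (A' & B' & _).
    specialize (Hpow r ltac:(lia)).
    unfold top_index. fold r n.
    assert (RE : 0 < Rpower t E) by apply Rpower_pos.
    destruct (Nat.even k); destruct HM as [HM1 HM2].
    + destruct (Fw (3 * q + 3)%nat ltac:(unfold m, ncon, r; lia)) as [-> _].
      rewrite HM1, <- HE in B, B'. split.
      * apply Hdiv with (1 := B). apply Dw. unfold m, ncon, r. lia.
      * apply Rle_trans with (1 := B'). apply Rmult_le_compat_r; lra.
    + destruct (Fw (3 * q + 2)%nat ltac:(unfold m, ncon, r; lia)) as [-> _].
      rewrite HM1, <- HE in A, A'. split.
      * apply Hdiv with (1 := A). apply Dw. unfold m, ncon, r. lia.
      * apply Rle_trans with (1 := A'). apply Rmult_le_compat_r; lra.
  - intros i Hi. unfold pd_dim in Hi. fold n m in Hi.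
    assert (Pmu : 0 < Rpower t l) by apply Rpower_pos.
    destruct (Nat.lt_ge_cases i n) as [I1|I1].
    { split; [now apply Fx|]. intros _. now apply Ux. }
    destruct (Nat.lt_ge_cases i (n + m)) as [I2|I2].
    { replace i with (n + (i - n))%nat by lia.
      destruct (Fw (i - n)%nat ltac:(lia)) as (-> & W & _). split; [assumption|].
      intros Hne. apply Uw; [lia|exact Hne]. }
    destruct (Nat.lt_ge_cases i (n + 2 * m)) as [I3|I3].
    { replace i with (n + m + (i - n - m))%nat by lia.
      destruct (Fw (i - n - m)%nat ltac:(lia)) as (W1 & W & ->). rewrite W1.
      split; [now apply Rdiv_lt_0_compat|]. intros _. apply Hinv, Lw. lia. }
    { replace i with (n + 2 * m + (i - n - 2 * m))%nat by lia.
      destruct (Fx (i - n - 2 * m)%nat ltac:(lia)) as (W & ->).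
      split; [now apply Rdiv_lt_0_compat|]. intros _. apply Hinv, Lx. lia. }
Qed.

(** * Angles and polygons *)

Lemma coord_le_vnorm d u i : (i < d)%nat -> Rabs (u i) <= vnorm d u.
Proof.
  intros Hi. unfold vnorm, dot. rewrite <- sqrt_Rsqr_abs. apply sqrt_le_1_alt.
  apply (sumn_term_le d (fun i => u i * u i)); [intros; nra|assumption].
Qed.

Lemma Rabs_dot_le d u v : Rabs (dot d u v) <= sumn d (fun i => Rabs (u i) * Rabs (v i)).
Proof.
  unfold dot. induction d as [|d IH]; simpl; [rewrite Rabs_R0; lra|].
  rewrite <- Rabs_mult. eapply Rle_trans; [apply Rabs_triang|]. lra.
Qed.

Lemma acos_ge_of_le_sin x th : 0 < th -> th < PI / 2 -> Rabs x <= sin th -> PI / 2 - th <= acos x.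
Proof.
  intros H0 H1 Hx. pose proof (SIN_bound th).
  assert (-1 <= x <= 1) by (unfold Rabs in Hx; destruct (Rcase_abs x); lra).
  apply Rnot_lt_le. intros Hlt. pose proof (acos_bound x).
  apply cos_decreasing_1 in Hlt; try lra.
  rewrite cos_acos, cos_shift in Hlt by assumption.
  pose proof (Rle_abs x). lra.
Qed.

(** As p and q differ, every product a_i b_i has a factor that is not dominant and is at most [e]
    |a| |b|. Summing, the cosine is at most d e in modulus. *)
Lemma vangle_of_dominant d a b p q e th :
  (p < d)%nat -> (q < d)%nat -> p <> q -> 0 < e ->
  0 < th -> th < PI / 2 -> INR d * e <= sin th ->
  a p <> 0 -> b q <> 0 ->
  (forall i, (i < d)%nat -> i <> p -> Rabs (a i) <= e * Rabs (a p)) ->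
  (forall i, (i < d)%nat -> i <> q -> Rabs (b i) <= e * Rabs (b q)) ->
  PI / 2 - th <= vangle d a b.
Proof.
  intros Hp Hq Hpq He Hth1 Hth2 Hs Ha Hb Da Db.
  pose proof (coord_le_vnorm d a p Hp) as Na. pose proof (coord_le_vnorm d b q Hq) as Nb.
  pose proof (Rabs_pos_lt _ Ha). pose proof (Rabs_pos_lt _ Hb).
  set (A := vnorm d a) in *. set (B := vnorm d b) in *.
  assert (HAB : 0 < A * B) by nra.
  (* The nonzero dominant coordinates exclude the conventional value 0 of the angle. *)
  unfold vangle. fold A B. destruct (Req_EM_T (A * B) 0); [lra|].
  apply acos_ge_of_le_sin; try assumption. apply Rle_trans with (2 := Hs).
  unfold Rdiv. rewrite Rabs_mult, Rabs_inv, (Rabs_pos_eq (A * B)) by lra.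
  apply Rmult_le_reg_r with (A * B); [assumption|].
  rewrite Rmult_assoc, Rinv_l, Rmult_1_r by lra.
  apply Rle_trans with (1 := Rabs_dot_le d a b).
  rewrite Rmult_assoc, <- sumn_const. apply sumn_le. intros i Hi.
  pose proof (coord_le_vnorm d a i Hi). pose proof (coord_le_vnorm d b i Hi).
  fold A in H1. fold B in H2. pose proof (Rabs_pos (a i)). pose proof (Rabs_pos (b i)).
  destruct (Nat.eq_dec i p) as [->|Hip].
  - specialize (Db p Hp Hpq).
    apply Rle_trans with (A * (e * B)); [|lra].
    apply Rmult_le_compat; try assumption. nra.
  - specialize (Da i Hi Hip).
    apply Rle_trans with ((e * A) * B); [|lra].
    apply Rmult_le_compat; try assumption. nra.
Qed.

(** [n] angles take n + 2 vertices. *)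
Lemma poly_curv_ge d (P : nat -> nat -> R) th n : forall a,
  (forall k, (a <= k < a + n)%nat ->
     th <= vangle d (vsub (P (S k)) (P k)) (vsub (P (S (S k))) (P (S k)))) ->
  INR n * th <= poly_curv d (map P (seq a (S (S n)))).
Proof.
  induction n as [|n IH]; intros a H.
  - simpl. lra.
  - assert (H1 := H a ltac:(lia)).
    assert (H2 : INR n * th <= poly_curv d (map P (seq (S a) (S (S n)))))
      by (apply IH; intros; apply H; lia).
    rewrite S_INR.
    change (poly_curv d (map P (seq a (S (S (S n))))))
      with (vangle d (vsub (P (S a)) (P a)) (vsub (P (S (S a))) (P (S a)))
            + poly_curv d (map P (seq (S a) (S (S n))))).
    lra.
Qed.

Lemma strictly_increasing_map_seq f n : (forall k, f k < f (S k)) ->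
  forall a, strictly_increasing (map f (seq a n)).
Proof.
  intros Hf. induction n as [|n IH]; intros a; [exact I|].
  destruct n as [|n]; [exact I|]. split; [apply Hf|]. apply (IH (S a)).
Qed.

(** * Total curvature of the central path *)

Lemma top_index_alternates q k : top_index q (S k) <> top_index q k.
Proof.
  unfold top_index. rewrite Nat.even_succ, <- Nat.negb_even. destruct (Nat.even k); simpl; lia.
Qed.

Lemma top_index_primal q k : (top_index q k < primal_dim (S q))%nat.
Proof. unfold top_index, primal_dim, ncon. destruct (Nat.even k); lia. Qed.

(** Off [p] both end points lie in (0, s] with s = C t^(E - d/2); at [p] the start is at most s and
    the end at least t^E / C. Dominance amounts to s <= e (t^E / C - s), that is, t^(d/2) >= C^2
    (1+e)/e. *)
Lemma grid_step_dominant q k t e : (1 <= q)%nat -> (S k <= 2 ^ q)%nat -> 1 <= t -> 0 < e ->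
  let C := spread (S q) in
  C * C * ((1 + e) / e) <= Rpower t (/ 2 ^ q / 2) ->
  let a := vsub (C_path (S q) t (grid q (S k))) (C_path (S q) t (grid q k)) in
  let p := top_index q (S k) in
  a p <> 0 /\
  forall i, (i < pd_dim (S q))%nat -> i <> p -> Rabs (a i) <= e * Rabs (a p).
Proof.
  intros Hq Hk Ht He C Hbig a p.
  pose proof (grid_range q k ltac:(lia)) as G0. pose proof (grid_range q (S k) Hk) as G1.
  destruct (central_dominant_coordinate q k t _ Hq ltac:(lia) Ht
              (C_path_central (S q) t _ Ht G0)) as [T0 A0].
  destruct (central_dominant_coordinate q (S k) t _ Hq Hk Ht
              (C_path_central (S q) t _ Ht G1)) as [T1 A1].
  fold C in T0, A0, T1, A1. fold p in T1, A1.
  set (P0 := C_path (S q) t (grid q k)) in *. set (P1 := C_path (S q) t (grid q (S k))) in *.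
  set (E := top_exp q (S k)) in *. set (d := / 2 ^ q) in *.
  pose proof (inv_pow2_bound q) as Hd. fold d in Hd.
  destruct (spread_ge (S q)) as (_ & _ & HC & _). fold C in HC.
  assert (HE : top_exp q k = E - d).
  { unfold E, top_exp. fold d. rewrite S_INR. ring. }
  rewrite HE in T0, A0.
  set (X := Rpower t E) in *. set (s := C * Rpower t (E - d / 2)) in *.
  assert (HX : 0 < X) by apply Rpower_pos.
  assert (Hs : s * (C * ((1 + e) / e)) <= X).
  { unfold X. replace E with (E - d / 2 + d / 2) by ring. rewrite Rpower_plus.
    unfold s. pose proof (Rpower_pos t (E - d / 2)) as Hp.
    replace (C * Rpower t (E - d / 2) * (C * ((1 + e) / e)))
      with (Rpower t (E - d / 2) * (C * C * ((1 + e) / e))) by ring.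
    apply Rmult_le_compat_l; lra. }
  assert (Hsm : s * (1 + e) <= e * (/ C * X)).
  { apply Rmult_le_reg_l with (C / e); [apply Rdiv_lt_0_compat; lra|].
    replace (C / e * (s * (1 + e))) with (s * (C * ((1 + e) / e))) by (field; lra).
    replace (C / e * (e * (/ C * X))) with X by (field; lra). assumption. }
  assert (Hs0 : 0 < s).
  { unfold s. apply Rmult_lt_0_compat; [lra|apply Rpower_pos]. }
  assert (B0 : forall i, (i < pd_dim (S q))%nat -> 0 < P0 i <= s).
  { intros i Hi. destruct (A0 i Hi) as [L0 U0]. split; [assumption|].
    (* Even the leading exponent E - d of the earlier point lies below E - d/2. *)
    assert (Hm : forall b, b <= E - d / 2 -> C * Rpower t b <= s).
    { intros b Hb. apply Rmult_le_compat_l; [lra|]. now apply Rle_Rpower. }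
    destruct (Nat.eq_dec i (top_index q k)) as [->|Hne].
    - apply Rle_trans with (1 := proj2 T0). apply Hm. lra.
    - apply Rle_trans with (1 := U0 Hne). apply Hm. lra. }
  assert (Hp : (p < pd_dim (S q))%nat).
  { pose proof (top_index_primal q (S k)) as H. fold p in H.
    unfold pd_dim, primal_dim in *. lia. }
  assert (Hap : / C * X - s <= a p).
  { unfold a, vsub. specialize (B0 p Hp). lra. }
  assert (Hap0 : 0 < a p) by nra.
  split; [lra|]. intros i Hi Hne. rewrite (Rabs_pos_eq (a p)) by lra.
  apply Rle_trans with s.
  - destruct (A1 i Hi) as [L1 U1]. specialize (U1 Hne). specialize (B0 i Hi).
    fold s in U1. unfold a, vsub. apply Rabs_le. lra.
  - nra.
Qed.

Lemma Rpower_eventually_ge b X : 0 < b -> 0 < X ->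
  exists T, 1 <= T /\ forall t, T <= t -> X <= Rpower t b.
Proof.
  intros Hb HX. exists (Rmax 1 (Rpower X (/ b))). split; [apply Rmax_l|].
  intros t Ht. pose proof (Rmax_l 1 (Rpower X (/ b))). pose proof (Rmax_r 1 (Rpower X (/ b))).
  rewrite <- (Rpower_1 X HX) at 1. rewrite <- (Rinv_l b) by lra. rewrite <- Rpower_mult.
  apply Rle_Rpower_l; [lra|]. split; [apply Rpower_pos|lra].
Qed.

(** The dominating coordinates are primal slacks, so one argument covers every truncation from the
    primal to the full primal-dual vector. *)
Lemma liminf_curvature_ge q d :
  (primal_dim (S q) <= d <= pd_dim (S q))%nat ->
  liminf_kappa_ge d (C_path (S q)) interval02 ((2 ^ q - 1) * (PI / 2)).
Proof.
  intros Hd eps Heps.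
  destruct (Nat.eq_dec q 0) as [->|Hq0].
  (* The bound is -eps here, which the empty polygon exceeds. *)
  { exists 0. intros t _. exists nil. repeat split; [constructor|]. simpl. lra. }
  assert (Hq : (1 <= q)%nat) by lia.
  assert (H2 : 1 <= 2 ^ q) by (apply pow_R1_Rle; lra).
  (* Each of the 2^q - 1 angles may fall short of PI/2 by [th], for a total loss below [eps]; the
     cap 1 keeps [th] under PI/2. *)
  set (th := Rmin 1 (eps / 2 ^ q)).
  assert (Hth0 : 0 < th) by (apply Rmin_glb_lt; [lra|apply Rdiv_lt_0_compat; lra]).
  assert (Hth1 : th < PI / 2)
    by (pose proof PI2_1; pose proof (Rmin_l 1 (eps / 2 ^ q)) as Hm; fold th in Hm; lra).
  assert (Hthe : (2 ^ q - 1) * th < eps).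
  { pose proof (Rmin_r 1 (eps / 2 ^ q)) as H. fold th in H.
    apply (Rmult_le_compat_l (2 ^ q)) in H; [|lra].
    replace (2 ^ q * (eps / 2 ^ q)) with eps in H by (field; lra). nra. }
  assert (Hsin : 0 < sin th) by (apply sin_gt_0; lra).
  set (e := sin th / (INR d + 1)). pose proof (pos_INR d) as HdR.
  assert (He : 0 < e) by (apply Rdiv_lt_0_compat; lra).
  assert (Hde : INR d * e <= sin th).
  { replace (sin th) with ((INR d + 1) * e) by (unfold e; field; lra). nra. }
  set (C := spread (S q)).
  destruct (spread_ge (S q)) as (_ & _ & HC & _). fold C in HC.
  destruct (Rpower_eventually_ge (/ 2 ^ q / 2) (C * C * ((1 + e) / e))) as (T & HT1 & HT).
  { pose proof (inv_pow2_bound q). lra. }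
  { apply Rmult_lt_0_compat; [nra|]. apply Rdiv_lt_0_compat; lra. }
  exists T. intros t Ht.
  assert (Hn : exists n, (2 ^ q = S n)%nat).
  { exists (2 ^ q - 1)%nat. pose proof (Nat.pow_nonzero 2 q). lia. }
  destruct Hn as [n Hn].
  assert (HnR : INR n = 2 ^ q - 1).
  { replace (2 ^ q) with (INR (2 ^ q)) by (rewrite pow_INR; reflexivity).
    rewrite Hn, S_INR. ring. }
  (* All 2^q + 1 grid points, with S n = 2^q. *)
  exists (map (grid q) (seq 0 (S (S n)))). split; [|split].
  - apply strictly_increasing_map_seq. intros k. unfold grid. rewrite S_INR.
    pose proof (inv_pow2_bound q). nra.
  - apply Forall_forall. intros x Hx. apply in_map_iff in Hx. destruct Hx as (k & <- & Hk).
    apply in_seq in Hk. apply grid_range. lia.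
  - rewrite map_map.
    assert (Hang : INR n * (PI / 2 - th) <=
              poly_curv d (map (fun k => C_path (S q) t (grid q k)) (seq 0 (S (S n))))).
    { apply (poly_curv_ge d (fun k => C_path (S q) t (grid q k))). intros k Hk.
      destruct (grid_step_dominant q k t e Hq ltac:(lia) ltac:(lra) He (HT t Ht)) as [N1 D1].
      destruct (grid_step_dominant q (S k) t e Hq ltac:(lia) ltac:(lra) He (HT t Ht)) as [N2 D2].
      pose proof (top_index_primal q (S k)). pose proof (top_index_primal q (S (S k))).
      eapply vangle_of_dominant with (p := top_index q (S k)) (q := top_index q (S (S k)))
        (e := e); try assumption; try lia.
      - apply not_eq_sym, top_index_alternates.
      - intros i Hi. apply D1. lia.
      - intros i Hi. apply D2. lia. }
    rewrite HnR in Hang. lra.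
Qed.

Lemma liminf_kappa_mono d sigma (I J : R -> Prop) L :
  (forall x, I x -> J x) -> liminf_kappa_ge d sigma I L -> liminf_kappa_ge d sigma J L.
Proof.
  intros HIJ H eps Heps. destruct (H eps Heps) as [T HT]. exists T. intros t Ht.
  destruct (HT t Ht) as (taus & H1 & H2 & H3). exists taus. repeat split; try assumption.
  now apply (Forall_impl J HIJ).
Qed.

Theorem mainTheorem18 (r : nat) (hr : (1 <= r)%nat) :
  let L := (2 ^ (r - 1) - 1) * (PI / 2) in
  liminf_kappa_ge (pd_dim r) (C_path r) interval02 L /\
  liminf_kappa_ge (primal_dim r) (C_path r) interval02 L /\
  liminf_kappa_ge (pd_dim r) (C_path r) whole_line L /\
  liminf_kappa_ge (primal_dim r) (C_path r) whole_line L.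
Proof.
  destruct r as [|q]; [lia|]. replace (S q - 1)%nat with q by lia. intros L.
  assert (H1 : liminf_kappa_ge (pd_dim (S q)) (C_path (S q)) interval02 L).
  { apply liminf_curvature_ge. unfold pd_dim, primal_dim. lia. }
  assert (H2 : liminf_kappa_ge (primal_dim (S q)) (C_path (S q)) interval02 L).
  { apply liminf_curvature_ge. unfold pd_dim, primal_dim. lia. }
  repeat split; try assumption;
    apply liminf_kappa_mono with (I := interval02); try assumption; exact (fun _ _ => I).
Qed.
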